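(* Fix an odd prime $p$. Let $c\in\mathbb{Q}$ and $f_c(x)=x^2+c$. (a) If $|c|_p\le 1$, then $\mathrm{PrePer}(f_c)\cap\mathbb{Q}^{\mathrm{tp}}$ is finite. (b) If $|c|_p>1$ and $-c$ is not a square in $\mathbb{Q}_p$, then $\mathrm{PrePer}(f_c)\cap\mathbb{Q}^{\mathrm{tp}}$ is empty. (c) If $|c|_p>1$ and $-c$ is a square in $\mathbb{Q}_p$, then $\mathrm{PrePer}(f_c)\subset\mathbb{Q}^{\mathrm{tp}}$; in particular, $\mathrm{PrePer}(f_c)$ contains infinitely many totally $p$-adic $f_c$-preperiodic points.
   Context: $|\cdot|_p$ is the usual $p$-adic absolute value, $\mathbb{Q}_p$ the field of $p$-adic numbers, and $\mathbb{C}_p$ the completion of an algebraic closure of $\mathbb{Q}_p$. For a polynomial $f$ with coefficients in $\overline{\mathbb{Q}}$, $f^n$ denotes the $n$-fold composition of $f$ with itself ($f^0$ is the identity). An algebraic number $\alpha\in\overline{\mathbb{Q}}$ is a preperiodic point of $f$ if $f^n(\alpha)=f^m(\alpha)$ for some integers $0\le m<n$. $\mathrm{PrePer}(f)$ denotes the set of all preperiodic points of $f$ in $\overline{\mathbb{Q}}$. An algebraic number $\alpha$ is totally $p$-adic if its minimal polynomial over $\mathbb{Q}$ splits completely over $\mathbb{Q}_p$ (equivalently, every embedding $\mathbb{Q}(\alpha)\hookrightarrow\mathbb{C}_p$ has image contained in $\mathbb{Q}_p$). $\mathbb{Q}^{\mathrm{tp}}$ denotes the set of all totally $p$-adic algebraic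 numbers. The symbol $\subset$ denotes (not necessarily strict) inclusion. *)

(* Defs.v *)
From HB Require Import structures.
From mathcomp Require Import all_boot all_order all_algebra all_field.
From mathcomp Require Import boolp classical_sets functions cardinality.
From mathcomp Require Import ring lra.
Set Implicit Arguments.
Unset Strict Implicit.
Unset Printing Implicit Defensive.
Import Order.TTheory GRing.Theory Num.Theory.
Local Open Scope ring_scope.

(* The case x = 0 is apart because logn p 0 = 0. *)
Definition padic_abs (p : nat) (x : rat) : rat :=
  if x == 0 then 0
  else p%:R ^+ logn p `|denq x|%N / p%:R ^+ logn p `|numq x|%N.

Section PadicAbs.
Variables (p : nat) (p_pr : prime p).

Let pX_gt0 k : 0 < p%:R ^+ k :> rat.
Proof. by rewrite exprn_gt0 // ltr0n prime_gt0. Qed.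

Let pX_neq0 k : p%:R ^+ k != 0 :> rat.
Proof. exact: lt0r_neq0. Qed.

Lemma padic_abs0 : padic_abs p 0 = 0. Proof. by rewrite /padic_abs eqxx. Qed.

Lemma padic_abs_frac (m n : int) : m != 0 -> n != 0 ->
  padic_abs p (m%:~R / n%:~R) = p%:R ^+ logn p `|n|%N / p%:R ^+ logn p `|m|%N.
Proof.
move=> m0 n0; set x := m%:~R / n%:~R : rat.
have x0 : x != 0 by rewrite mulf_neq0 ?invr_eq0 ?intr_eq0.
rewrite /padic_abs (negbTE x0); apply/eqP; rewrite eqr_div // -!exprD.
suff E : numq x * n = m * denq x.
  have := congr1 (fun z => logn p `|z|%N) E.
  rewrite /= !abszM !lognM ?absz_gt0 ?numq_eq0 ?denq_neq0 // => E'.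
  by apply/eqP; congr (_ ^+ _); rewrite addnC -E' addnC.
apply: (@intr_inj rat); rewrite !rmorphM /=; apply/eqP.
by rewrite -eqr_div ?intr_eq0 ?denq_neq0 // divq_num_den.
Qed.

Lemma padic_abs_gt0 x : (0 < padic_abs p x) = (x != 0).
Proof.
rewrite /padic_abs; case: eqP => _ /=; first by rewrite ltxx.
by rewrite divr_gt0.
Qed.

Lemma padic_abs_ge0 x : 0 <= padic_abs p x.
Proof.
have [->|x0] := eqVneq x 0; first by rewrite padic_abs0.
by rewrite ltW // padic_abs_gt0.
Qed.

Lemma padic_abs1 : padic_abs p 1 = 1.
Proof. by rewrite /padic_abs oner_eq0 /= logn1 divr1. Qed.

Lemma padic_absN x : padic_abs p (- x) = padic_abs p x.
Proof. by rewrite /padic_abs oppr_eq0 denqN numqN abszN. Qed.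

Lemma padic_absM x y : padic_abs p (x * y) = padic_abs p x * padic_abs p y.
Proof.
have [->|x0] := eqVneq x 0; first by rewrite mul0r padic_abs0 mul0r.
have [->|y0] := eqVneq y 0; first by rewrite mulr0 padic_abs0 mulr0.
have -> : x * y = (numq x * numq y)%:~R / (denq x * denq y)%:~R.
  by rewrite !rmorphM /= -mulf_div !divq_num_den.
rewrite padic_abs_frac ?mulf_neq0 ?numq_eq0 ?denq_neq0 //.
rewrite !abszM !lognM ?absz_gt0 ?numq_eq0 ?denq_neq0 // !exprD -mulf_div.
by rewrite /padic_abs (negbTE x0) (negbTE y0).
Qed.

Lemma padic_absV x : padic_abs p (x^-1) = (padic_abs p x)^-1.
Proof.
have [->|x0] := eqVneq x 0; first by rewrite !(invr0, padic_abs0).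
apply: (mulfI (lt0r_neq0 (_ : 0 < padic_abs p x))).
  by rewrite padic_abs_gt0.
by rewrite -padic_absM !mulfV ?padic_abs1 // lt0r_neq0 // padic_abs_gt0.
Qed.

Lemma padic_absD x y :
  padic_abs p (x + y) <= Num.max (padic_abs p x) (padic_abs p y).
Proof.
have [->|x0] := eqVneq x 0; first by rewrite add0r le_max lexx orbT.
have [->|y0] := eqVneq y 0; first by rewrite addr0 le_max lexx.
have [->|xy0] := eqVneq (x + y) 0.
  by rewrite padic_abs0 le_max padic_abs_ge0.
pose a := numq x * denq y; pose b := numq y * denq x.
pose d := denq x * denq y.
have dx0 : (denq x)%:~R != 0 :> rat by rewrite intr_eq0 denq_neq0.
have dy0 : (denq y)%:~R != 0 :> rat by rewrite intr_eq0 denq_neq0.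
have d0 : d != 0 by rewrite mulf_neq0 ?denq_neq0.
have a0 : a != 0 by rewrite mulf_neq0 ?denq_neq0 ?numq_eq0.
have b0 : b != 0 by rewrite mulf_neq0 ?denq_neq0 ?numq_eq0.
have Ex : x = a%:~R / d%:~R.
  by rewrite -[LHS]divq_num_den !rmorphM /= -mulf_div divff // mulr1.
have Ey : y = b%:~R / d%:~R.
  rewrite -[LHS]divq_num_den !rmorphM /= [_%:~R * (denq y)%:~R]mulrC.
  by rewrite -mulf_div divff // mulr1.
have Exy : x + y = (a + b)%:~R / d%:~R by rewrite rmorphD /= mulrDl -Ex -Ey.
have ab0 : a + b != 0.
  by apply: contraNneq xy0 => ab0; rewrite Exy ab0 mul0r.
rewrite Exy Ex Ey !padic_abs_frac // le_max !ler_pM2l // !lef_pV2 ?posrE //.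
have p1 : 1 < p%:R :> rat by rewrite ltr1n prime_gt1.
rewrite !(ler_eXn2l p1) -geq_min.
have ab_gt0 : (0 < absz (a + b)%R)%N by rewrite absz_gt0.
rewrite -pfactor_dvdn //; set k := minn _ _.
have dvda : (Posz (p ^ k) %| a)%Z.
  by rewrite dvdzE /= pfactor_dvdn ?absz_gt0 // geq_minl.
have dvdb : (Posz (p ^ k) %| b)%Z.
  by rewrite dvdzE /= pfactor_dvdn ?absz_gt0 // geq_minr.
by have := rpredD dvda dvdb; rewrite dvdzE.
Qed.

Lemma padic_absD_lt x y e :
  padic_abs p x < e -> padic_abs p y < e -> padic_abs p (x + y) < e.
Proof. by move=> xe ye; rewrite (le_lt_trans (padic_absD _ _)) // gt_max xe. Qed.

End PadicAbs.

(* Q_p is the completion of rat for padic_abs p: Cauchy sequences modulo null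
   sequences. The primality proof is a parameter of the types so that the field
   instance can be attached to them. *)
Definition padic_cauchy (p : nat) of prime p : {pred nat -> rat} :=
  fun u => `[< forall e : rat, 0 < e -> exists N : nat,
    forall m n : nat, (N <= m)%N -> (N <= n)%N ->
      padic_abs p (u m - u n) < e >].

Section CauchyRing.
Variables (p : nat) (p_pr : prime p).

Lemma padic_cauchy_bounded u : u \in padic_cauchy p_pr ->
  exists2 B, 0 < B & forall n, padic_abs p (u n) <= B.
Proof.
move=> /asboolP /(_ 1 ltr01) [N HN].
have S0 : 0 <= \sum_(i < N.+1) padic_abs p (u i).
  by rewrite sumr_ge0 // => i _; rewrite padic_abs_ge0.
have leS i :
    (i <= N)%N -> padic_abs p (u i) <= \sum_(i < N.+1) padic_abs p (u i).
  move=> iN; rewrite (bigD1 (Ordinal (iN : (i < N.+1)%N))) //= lerDl.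
  by rewrite sumr_ge0 // => j _; rewrite padic_abs_ge0.
exists (1 + \sum_(i < N.+1) padic_abs p (u i)); first by rewrite ltr_pwDl.
move=> n; have [nN|Nn] := leqP n N; first by rewrite ler_wpDl // leS.
rewrite -[u n](subrK (u N)) (le_trans (padic_absD p_pr _ _)) // ge_max.
rewrite ler_wpDr ?ler_wpDl ?leS //.
by rewrite ltW // HN // ltnW.
Qed.

Lemma padic_cauchy_subring : subring_closed (padic_cauchy p_pr).
Proof.
split.
- by apply/asboolP => e e0; exists 0 => m n _ _; rewrite subrr padic_abs0.
- move=> u v /asboolP Hu /asboolP Hv; apply/asboolP => e e0.
  have [N HN] := Hu e e0; have [M HM] := Hv e e0.
  exists (maxn N M) => m n; rewrite !geq_max => /andP[Nm Mm] /andP[Nn Mn].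
  have -> : (u - v) m - (u - v) n = (u m - u n) + - (v m - v n).
    by rewrite !fctE; ring.
  by apply: padic_absD_lt => //; rewrite ?padic_absN; auto.
- move=> u v Cu Cv.
  have [B B0 HB] := padic_cauchy_bounded Cu.
  have [D D0 HD] := padic_cauchy_bounded Cv.
  apply/asboolP => e e0.
  move: Cu Cv => /asboolP/(_ (e / D)) [|N HN]; first by rewrite divr_gt0.
  move=> /asboolP/(_ (e / B)) [|M HM]; first by rewrite divr_gt0.
  exists (maxn N M) => m n; rewrite !geq_max => /andP[Nm Mm] /andP[Nn Mn].
  have -> : (u * v) m - (u * v) n = u m * (v m - v n) + v n * (u m - u n).
    by rewrite !fctE; ring.
  apply: padic_absD_lt => //; rewrite padic_absM //.
    rewrite (le_lt_trans (ler_wpM2r _ (HB m))) ?padic_abs_ge0 //.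
    by rewrite mulrC -ltr_pdivlMr // HM.
  rewrite (le_lt_trans (ler_wpM2r _ (HD n))) ?padic_abs_ge0 //.
  by rewrite mulrC -ltr_pdivlMr // HN.
Qed.

HB.instance Definition _ :=
  GRing.isSubringClosed.Build (nat -> rat) (padic_cauchy p_pr)
    padic_cauchy_subring.

Record cauchy_seq :=
  CauchySeq { seq_val :> nat -> rat; _ : seq_val \in padic_cauchy p_pr }.
HB.instance Definition _ := [isSub for seq_val].
HB.instance Definition _ := [Choice of cauchy_seq by <:].
HB.instance Definition _ := [SubChoice_isSubComNzRing of cauchy_seq by <:].

Definition padic_null : {pred cauchy_seq} :=
  fun u => `[< forall e : rat, 0 < e -> exists N : nat,
    forall n : nat, (N <= n)%N -> padic_abs p (u n) < e >].

Lemma padic_null_idealr : idealr_closed padic_null.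
Proof.
split.
- by apply/asboolP => e e0; exists 0 => n _; rewrite padic_abs0.
- apply/negP => /asboolP /(_ 1 ltr01) [N /(_ N (leqnn N))].
  by rewrite padic_abs1 // ltxx.
- move=> a u v /asboolP Hu /asboolP Hv; apply/asboolP => e e0.
  have [B B0 HB] := padic_cauchy_bounded (valP a).
  have [|N HN] := Hu (e / B); first by rewrite divr_gt0.
  have [M HM] := Hv e e0.
  exists (maxn N M) => n; rewrite !geq_max => /andP[Nn Mn].
  apply: padic_absD_lt => //; last exact: HM.
  rewrite padic_absM // (le_lt_trans (ler_wpM2r _ (HB n))) ?padic_abs_ge0 //.
  by rewrite mulrC -ltr_pdivlMr // HN.
Qed.

HB.instance Definition _ :=
  isIdealr.Build cauchy_seq padic_null padic_null_idealr.

Lemma padic_nonnull (u : cauchy_seq) : u \notin padic_null ->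
  exists2 e, 0 < e & exists N, forall n, (N <= n)%N -> e <= padic_abs p (u n).
Proof.
move=> /asboolPn /existsNP [e] /not_implyP [e0 /forallNP H].
exists e => //; have /asboolP /(_ e e0) [N HN] := valP u.
have [n] := (existsNP _).2 (H N) => /not_implyP [Nn /negP]; rewrite -leNgt => en.
exists N => m Nm; have := padic_absD p_pr (u n - u m) (u m).
rewrite subrK => /(le_trans en); rewrite le_max leNgt HN //.
Qed.

Lemma padic_cauchyV (u : cauchy_seq) : u \notin padic_null ->
  (fun n => (u n)^-1) \in padic_cauchy p_pr.
Proof.
move=> /padic_nonnull [d d0 [N HN]]; apply/asboolP => e e0.
have /asboolP /(_ (e * (d * d))) [|M HM] := valP u; first by rewrite !mulr_gt0.
exists (maxn N M) => m n; rewrite !geq_max => /andP[Nm Mm] /andP[Nn Mn].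
have um0 : u m != 0 by rewrite -(padic_abs_gt0 p_pr) (lt_le_trans d0) ?HN.
have un0 : u n != 0 by rewrite -(padic_abs_gt0 p_pr) (lt_le_trans d0) ?HN.
have -> : (u m)^-1 - (u n)^-1 = (u n - u m) / (u m * u n).
  by field; rewrite um0 un0.
rewrite padic_absM // padic_absV // padic_absM // ltr_pdivrMr; last first.
  by rewrite mulr_gt0 // padic_abs_gt0.
rewrite (lt_le_trans (HM n m Mn Mm)) // ler_pM2l //.
by rewrite ler_pM ?HN // ltW.
Qed.

Definition Qp := {ideal_quot padic_null}.
HB.instance Definition _ := GRing.ComNzRing.on Qp.

Local Open Scope quotient_scope.

Definition Qp_inv (x : Qp) : Qp :=
  if x == 0 then 0
  else \pi_Qp (insubd (0 : cauchy_seq) (fun n => (repr x n)^-1)).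

Lemma Qp_mulVf (x : Qp) : x != 0 -> Qp_inv x * x = 1.
Proof.
move=> x0; rewrite /Qp_inv (negbTE x0); set v := insubd _ _.
have Nx : repr x \notin padic_null.
  apply: contraNN x0 => Nx; rewrite -[x]reprK -(rmorph0 (\pi_Qp)).
  by rewrite -Quotient.idealrBE subr0.
have vE n : v n = (repr x n)^-1.
  by rewrite /v -[seq_val _]/(val _) insubdK //; exact: padic_cauchyV.
rewrite -[X in _ * X = _]reprK -rmorphM -(rmorph1 (\pi_Qp)); apply/eqP.
rewrite -Quotient.idealrBE; apply/asboolP => e e0.
have [d d0 [N HN]] := padic_nonnull Nx.
exists N => n Nn.
have -> : (v * repr x - 1) n = v n * repr x n - 1 by [].
have xn0 : repr x n != 0 by rewrite -(padic_abs_gt0 p_pr) (lt_le_trans d0) ?HN.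
by rewrite vE mulVf // subrr padic_abs0.
Qed.

Lemma Qp_inv0 : Qp_inv 0 = 0. Proof. by rewrite /Qp_inv eqxx. Qed.

HB.instance Definition _ := GRing.ComNzRing_isField.Build Qp Qp_mulVf Qp_inv0.

Lemma padic_cauchy_cst (x : rat) : (fun=> x) \in padic_cauchy p_pr.
Proof.
by apply/asboolP => e e0; exists 0 => m n _ _; rewrite subrr padic_abs0.
Qed.

Definition cauchy_cst (x : rat) : cauchy_seq := CauchySeq (padic_cauchy_cst x).

Lemma cauchy_cst_zmod_morphism : zmod_morphism cauchy_cst.
Proof. by move=> x y; apply/val_inj/funext. Qed.

Lemma cauchy_cst_monoid_morphism : monoid_morphism cauchy_cst.
Proof. by split=> [|x y]; apply/val_inj/funext. Qed.

HB.instance Definition _ :=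
  GRing.isZmodMorphism.Build rat cauchy_seq cauchy_cst cauchy_cst_zmod_morphism.
HB.instance Definition _ :=
  GRing.isMonoidMorphism.Build rat cauchy_seq cauchy_cst
    cauchy_cst_monoid_morphism.

(* Hence the library's ratr is the embedding of rat by constant sequences. *)
Lemma ratr_Qp (x : rat) : ratr x = \pi_Qp (cauchy_cst x) :> Qp.
Proof.
by rewrite -(fmorph_eq_rat (\pi_Qp \o cauchy_cst : {rmorphism rat -> Qp})).
Qed.

End CauchyRing.

Local Open Scope classical_set_scope.

Definition poly_iter (f : {poly algC}) (n : nat) : {poly algC} :=
  iter n (fun g => f \Po g) 'X.

Definition PrePer (f : {poly algC}) : set algC :=
  [set a | exists m n : nat,
    (m < n)%N /\ (poly_iter f n).[a] = (poly_iter f m).[a]].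

(* minCpoly a is the minimal polynomial of a over Q, with its coefficients seen
   in algC; P is the same polynomial with coefficients in rat. *)
Definition totally_padic (p : nat) (p_pr : prime p) (a : algC) : Prop :=
  exists2 P : {poly rat}, map_poly ratr P = minCpoly a &
    exists s : seq (Qp p_pr), map_poly ratr P = \prod_(b <- s) ('X - b%:P).

Definition Qtp (p : nat) (p_pr : prime p) : set algC :=
  [set a | totally_padic p_pr a].

Definition fc (c : rat) : {poly algC} := 'X^2 + (ratr c)%:P.

Definition is_square_Qp (p : nat) (p_pr : prime p) (c : rat) : Prop :=
  exists y : Qp p_pr, y ^+ 2 = ratr c.

(* Main.v *)
(* Parts (b) and (c) come from dynamics on Q_p. If |c| > 1, a preperiodic point
   x in Q_p satisfies |x|^2 = |f x|^2 = |c|, so -c / x^2 = 1 - f x / x^2 is within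
   distance < 1 of 1 and is a square. Conversely, if s^2 = -c, the two branches of
   f^{-1} are contractions of the ball |y| <= |s| of Q_p, so each of the 2^k words
   of length k in them has a fixed point: f^k - X splits over Q_p with simple
   roots, and being totally p-adic passes to preimages.

   Part (a) is a Vandermonde estimate in the spirit of Fekete. Let z_1, ..., z_n
   form a Galois-stable set of totally p-adic preperiodic points, V its Vandermonde
   determinant, d the denominator of c and 2^l >= n. Replacing the monomials by
   monic products of iterates of f, which are bounded at preperiodic points, shows
   that d^(nl) V is an algebraic integer and |V| <= n! (1 + |c|)^(nl). Replacing
   them by the polynomials (X^p - X)^(k / p) X^(k mod p) shows that V is divisible
   by p^T with T = sum_(k < n) floor (k / p), because (z^p - z) / p is p-integral
   when z is totally p-adic. As V^2 is rational and nonzero,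
   p^T <= d^(nl) n! (1 + |c|)^(nl), which fails for large n since T is of order
   n^2 while l may be taken of order log n. *)
From HB Require Import structures.
Require Import Defs.
From mathcomp Require Import all_boot all_order all_algebra all_field.
From mathcomp Require Import perm.
From mathcomp Require Import boolp classical_sets functions cardinality.
From mathcomp Require Import ring zify lra.
Set Implicit Arguments.
Unset Strict Implicit.
Unset Printing Implicit Defensive.
Import Order.TTheory GRing.Theory Num.Theory.
Local Open Scope classical_set_scope.
Local Open Scope ring_scope.

(** * The absolute value of Q_p *)

Section QpAbs.
Local Open Scope quotient_scope.
Variables (p : nat) (p_pr : prime p).
Local Notation pa := (padic_abs p).
Local Notation Qp := (Qp p_pr).

Lemma padic_abs_isosceles (x y : rat) : pa (x - y) < pa y -> pa x = pa y.
Proof.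
move=> xy; apply/eqP; rewrite eq_le; apply/andP; split.
  rewrite -[x](subrK y) (le_trans (padic_absD p_pr _ _)) // ge_max lexx andbT.
  exact: ltW.
have := padic_absD p_pr (y - x) x; rewrite subrK le_max.
by rewrite -opprB padic_absN leNgt xy.
Qed.

Lemma Qp_pi_eq0 (u : cauchy_seq p_pr) :
  (\pi_Qp u == 0) = (u \in @padic_null p p_pr).
Proof.
rewrite -[u in RHS]subr0 Quotient.idealrBE.
by rewrite -[0 in LHS](rmorph0 (\pi_Qp)).
Qed.

(** By the isosceles property the absolute value is eventually constant along a Cauchy sequence that
    is not null, with the same final value for equivalent sequences. Hence the absolute value of Q_p
    can be taken in [rat]. *)
Lemma Qp_abs_ex (x : Qp) : exists v : rat,
  if x == 0 then v = 0 else
  0 < v /\ forall u, \pi_Qp u = x ->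
           exists N, forall n, (N <= n)%N -> pa (u n) = v.
Proof.
have [x0|x0] := eqVneq x 0; first by exists 0.
have Nx : repr x \notin @padic_null p p_pr by rewrite -Qp_pi_eq0 reprK.
have [e e0 [N HN]] := padic_nonnull Nx.
have /asboolP /(_ e e0) [M HM] := valP (repr x).
pose K := maxn N M.
have HK n : (K <= n)%N -> pa (repr x n) = pa (repr x K).
  move=> Kn; apply: padic_abs_isosceles; rewrite (lt_le_trans (HM _ _ _ _)) //.
  - by rewrite (leq_trans _ Kn) // leq_maxr.
  - by rewrite leq_maxr.
  - by rewrite HN // leq_maxl.
exists (pa (repr x K)); split; first by rewrite (lt_le_trans e0) ?HN ?leq_maxl.
move=> u ux; have : u - repr x \in @padic_null p p_pr.
  by rewrite -Qp_pi_eq0 rmorphB /= ux reprK subrr.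
move=> /asboolP /(_ e e0) [M' HM']; exists (maxn K M') => n.
rewrite geq_max => /andP[Kn M'n]; rewrite -(HK n Kn).
apply: padic_abs_isosceles; rewrite (lt_le_trans (HM' _ M'n)) //.
by rewrite HN // (leq_trans _ Kn) // leq_maxl.
Qed.

Definition Qp_abs (x : Qp) : rat := sval (cid (Qp_abs_ex x)).

Lemma Qp_abs_gt0 x : (0 < Qp_abs x) = (x != 0).
Proof.
rewrite /Qp_abs; case: cid => v /=; case: eqP => [_ ->|_ [-> _]] //.
Qed.

Lemma Qp_abs0 : Qp_abs 0 = 0.
Proof. by rewrite /Qp_abs; case: cid => v /=; rewrite eqxx. Qed.

Lemma Qp_abs_eq0 x : (Qp_abs x == 0) = (x == 0).
Proof.
have [->|x0] := eqVneq x 0; first by rewrite Qp_abs0 eqxx.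
by rewrite gt_eqF // Qp_abs_gt0.
Qed.

Lemma Qp_abs_ge0 x : 0 <= Qp_abs x.
Proof.
by have [->|x0] := eqVneq x 0; rewrite ?Qp_abs0 // ltW // Qp_abs_gt0.
Qed.

Lemma Qp_absE (u : cauchy_seq p_pr) : \pi_Qp u != 0 ->
  exists N, forall n, (N <= n)%N -> pa (u n) = Qp_abs (\pi_Qp u).
Proof.
rewrite /Qp_abs; case: cid => v /=; case: eqP => // _ [_ H] _.
exact: H.
Qed.

Lemma Qp_abs_le (u : cauchy_seq p_pr) e N : 0 <= e ->
  (forall n, (N <= n)%N -> pa (u n) <= e) -> Qp_abs (\pi_Qp u) <= e.
Proof.
move=> e0 H; have [->|u0] := eqVneq (\pi_Qp u) 0; first by rewrite Qp_abs0.
have [M HM] := Qp_absE u0; rewrite -(HM (maxn N M)) ?leq_maxr //.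
by rewrite H ?leq_maxl.
Qed.

Lemma Qp_absM x y : Qp_abs (x * y) = Qp_abs x * Qp_abs y.
Proof.
have [->|x0] := eqVneq x 0; first by rewrite mul0r Qp_abs0 mul0r.
have [->|y0] := eqVneq y 0; first by rewrite mulr0 Qp_abs0 mulr0.
move: x0 y0; elim/quotW: x => u; elim/quotW: y => v u0 v0.
have uv0 : \pi_Qp (u * v) != 0 by rewrite rmorphM; exact: (mulf_neq0 u0 v0).
have [N HN] := Qp_absE u0; have [M HM] := Qp_absE v0.
have [K HK] := Qp_absE uv0; pose n := maxn K (maxn N M).
rewrite -rmorphM -(HK n) ?leq_maxl // -(HN n) -?(HM n).
- by rewrite -padic_absM.
- by rewrite !leq_max leqnn !orbT.
- by rewrite !leq_max leqnn !orbT.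
Qed.

Lemma Qp_absD x y : Qp_abs (x + y) <= Num.max (Qp_abs x) (Qp_abs y).
Proof.
have [->|x0] := eqVneq x 0; first by rewrite add0r le_max lexx orbT.
have [->|y0] := eqVneq y 0; first by rewrite addr0 le_max lexx.
move: x0 y0; elim/quotW: x => u; elim/quotW: y => v u0 v0.
have [N HN] := Qp_absE u0; have [M HM] := Qp_absE v0.
rewrite -rmorphD; apply: (@Qp_abs_le _ _ (maxn N M)).
  by rewrite le_max Qp_abs_ge0.
move=> n; rewrite geq_max => /andP[Nn Mn]; rewrite -(HN n) // -(HM n) //.
exact: padic_absD.
Qed.

Lemma Qp_abs1 : Qp_abs 1 = 1.
Proof.
have n0 : Qp_abs 1 != 0 by rewrite Qp_abs_eq0 oner_eq0.
by apply: (mulfI n0); rewrite -Qp_absM !mulr1.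
Qed.

Lemma Qp_absN x : Qp_abs (- x) = Qp_abs x.
Proof.
apply/eqP; rewrite -(@eqrXn2 _ 2) ?Qp_abs_ge0 //.
by rewrite !expr2 -!Qp_absM mulrNN.
Qed.

Lemma Qp_absB x y : Qp_abs (x - y) = Qp_abs (y - x).
Proof. by rewrite -opprB Qp_absN. Qed.

Lemma Qp_absX x n : Qp_abs (x ^+ n) = Qp_abs x ^+ n.
Proof.
by elim: n => [|n IH]; rewrite ?expr0 ?Qp_abs1 // !exprS Qp_absM IH.
Qed.

Lemma Qp_absV x : Qp_abs x^-1 = (Qp_abs x)^-1.
Proof.
have [->|x0] := eqVneq x 0; first by rewrite invr0 Qp_abs0 invr0.
have n0 : Qp_abs x != 0 by rewrite Qp_abs_eq0.
by apply: (mulfI n0); rewrite -Qp_absM !mulfV // Qp_abs1.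
Qed.

Lemma Qp_absD_le x y e : Qp_abs x <= e -> Qp_abs y <= e -> Qp_abs (x + y) <= e.
Proof. by move=> xe ye; rewrite (le_trans (Qp_absD _ _)) // ge_max xe. Qed.

Lemma Qp_absD_lt x y e : Qp_abs x < e -> Qp_abs y < e -> Qp_abs (x + y) < e.
Proof. by move=> xe ye; rewrite (le_lt_trans (Qp_absD _ _)) // gt_max xe. Qed.

Lemma Qp_absDr x y : Qp_abs x < Qp_abs y -> Qp_abs (x + y) = Qp_abs y.
Proof.
move=> xy; apply/eqP; rewrite eq_le Qp_absD_le ?(ltW xy) //=.
have := Qp_absD (x + y) (- x); rewrite Qp_absN addrAC subrr add0r le_max.
by rewrite [X in _ || X]leNgt xy orbF.
Qed.

(** The same function as [ratr], packaged as a ring morphism so that it can be used under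
    [map_poly]. *)
Definition Qp_of_rat : rat -> Qp := \pi_Qp \o @cauchy_cst p p_pr.
HB.instance Definition _ := GRing.RMorphism.on Qp_of_rat.

Lemma Qp_ratr : ratr =1 Qp_of_rat.
Proof. exact: ratr_Qp. Qed.

Lemma map_poly_ratr_Qp (P : {poly rat}) :
  map_poly (ratr : rat -> Qp) P = map_poly Qp_of_rat P.
Proof. by apply: eq_map_poly => x; rewrite Qp_ratr. Qed.

Lemma Qp_abs_rat q : Qp_abs (Qp_of_rat q) = pa q.
Proof.
have [->|q0] := eqVneq q 0; first by rewrite rmorph0 Qp_abs0 padic_abs0.
have : Qp_of_rat q != 0 by rewrite fmorph_eq0.
by case/Qp_absE => N /(_ N (leqnn N)).
Qed.

Lemma Qp_dense (x : Qp) e : 0 < e -> exists q, Qp_abs (x - Qp_of_rat q) <= e.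
Proof.
move=> e0; elim/quotW: x => u.
have /asboolP /(_ e e0) [N HN] := valP u; exists (u N).
rewrite -rmorphB; apply: (@Qp_abs_le _ _ N); first exact: ltW.
by move=> n Nn; rewrite ltW // HN.
Qed.

(** * Completeness, contractions and square roots in Q_p *)

Lemma geometric_small (r e : rat) : 0 <= r -> r < 1 -> 0 < e ->
  exists N, forall n, (N <= n)%N -> r ^+ n < e.
Proof.
move=> r0 r1 e0; suff [N HN] : exists N, r ^+ N < e.
  exists N => n Nn; rewrite (le_lt_trans _ HN) // ler_wiXn2l //.
  exact: ltW.
have [->|rn0] := eqVneq r 0; first by exists 1%N; rewrite expr1.
have rp : 0 < r by rewrite lt_def rn0.
pose d := r^-1 - 1; have d0 : 0 < d by rewrite subr_gt0 invf_gt1.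
(* Bernoulli's inequality for r^-1 = 1 + d. *)
have bern n : n%:R * d < (r ^+ n)^-1.
  suff : 1 + n%:R * d <= (r ^+ n)^-1 by lra.
  elim: n => [|n IH]; first by rewrite mul0r addr0 expr0 invr1.
  have -> : (r ^+ n.+1)^-1 = (r ^+ n)^-1 * (1 + d).
    by rewrite exprSr invfM /d addrC subrK.
  rewrite -natr1; have : 0 <= n%:R :> rat by [].
  nra.
have H : 0 <= (e * d)^-1 by rewrite invr_ge0 mulr_ge0 // ltW.
exists (Num.Def.archi_bound (e * d)^-1).
have := archi_boundP H; set N := Num.Def.archi_bound _ => HN.
have := lt_trans _ (bern N); move=> /(_ e^-1) => H2.
rewrite -ltf_pV2 ?posrE ?exprn_gt0 //; apply: H2.
by rewrite -ltr_pdivrMr // -invfM.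
Qed.

Lemma inv_p_lt1 : 0 <= (p%:R^-1 : rat) < 1.
Proof.
rewrite invr_ge0 ler0n invf_lt1 ?ltr1n ?ltr0n ?prime_gt1 //.
exact: prime_gt0.
Qed.

(** Rationals [q n] within p^-n of [x n] form a Cauchy sequence, whose class is the limit. *)
Lemma Qp_complete (x : nat -> Qp) :
  (forall e, 0 < e -> exists N, forall m n, (N <= m)%N -> (N <= n)%N ->
     Qp_abs (x m - x n) < e) ->
  exists l, forall e, 0 < e -> exists N, forall n, (N <= n)%N ->
     Qp_abs (x n - l) < e.
Proof.
move=> Cx; have /andP[r0 r1] := inv_p_lt1; set r : rat := p%:R^-1 in r0 r1.
have rp : 0 < r by rewrite invr_gt0 ltr0n prime_gt0.
have /choice [q Hq] : forall n, exists q, Qp_abs (x n - Qp_of_rat q) <= r ^+ n.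
  by move=> n; apply: Qp_dense; rewrite exprn_gt0.
have Hq' e : 0 < e -> exists N, forall n, (N <= n)%N ->
    Qp_abs (x n - Qp_of_rat (q n)) < e.
  move=> e0; have [N HN] := geometric_small r0 r1 e0.
  by exists N => n Nn; rewrite (le_lt_trans (Hq n)) ?HN.
have Cq : q \in padic_cauchy p_pr.
  apply/asboolP => e e0; have [N HN] := Cx e e0; have [M HM] := Hq' e e0.
  exists (maxn N M) => m n; rewrite !geq_max => /andP[Nm Mm] /andP[Nn Mn].
  rewrite -Qp_abs_rat rmorphB /=.
  have -> : Qp_of_rat (q m) - Qp_of_rat (q n)
     = - (x m - Qp_of_rat (q m)) + ((x n - Qp_of_rat (q n)) + (x m - x n)).
    by ring.
  apply: Qp_absD_lt; first by rewrite Qp_absN HM.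
  by apply: Qp_absD_lt; [exact: HM | exact: HN].
pose u := CauchySeq Cq; exists (\pi_Qp u) => e e0.
(* The bound given by [Qp_abs_le] is not strict, so the Cauchy condition is used with e / 2. *)
have [N HN] := Hq' e e0; have e20 : 0 < e / 2%:R by rewrite divr_gt0.
have /asboolP /(_ _ e20) [M HM] := valP u.
exists (maxn N M) => n; rewrite geq_max => /andP[Nn Mn].
rewrite -[x n](subrK (Qp_of_rat (q n))) -addrA Qp_absD_lt ?HN //.
apply: (@le_lt_trans _ _ (e / 2%:R)); last by lra.
rewrite -[_ - _](rmorphB (\pi_Qp) (cauchy_cst p_pr (q n)) u).
apply: (@Qp_abs_le _ _ M); first exact: ltW.
by move=> k Mk; rewrite ltW // HM.
Qed.

(** The iteration starts at the centre, so [x m] and [x (m + n)] are images under the m-th iterate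
    of two points of the ball: they are within r^m rho, and no geometric series is summed. *)
Lemma Qp_banach (T : Qp -> Qp) (a : Qp) (rho r : rat) : 0 <= r -> r < 1 ->
  (forall x, Qp_abs (x - a) <= rho -> Qp_abs (T x - a) <= rho) ->
  (forall x y, Qp_abs (x - a) <= rho -> Qp_abs (y - a) <= rho ->
     Qp_abs (T x - T y) <= r * Qp_abs (x - y)) ->
  0 <= rho -> exists2 x, Qp_abs (x - a) <= rho & T x = x.
Proof.
move=> r0 r1 TB TC rho0; pose x n := iter n T a.
have xB n : Qp_abs (x n - a) <= rho.
  by elim: n => [|n IH]; rewrite ?subrr ?Qp_abs0 //=; apply: TB.
have xC m n : Qp_abs (x m - x (m + n)%N) <= r ^+ m * rho.
  elim: m => [|m IH]; first by rewrite add0n expr0 mul1r Qp_absB xB.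
  by rewrite (le_trans (TC _ _ _ _)) // exprS -mulrA ler_wpM2l.
have [|l Hl] := @Qp_complete x.
  move=> e e0; have [|N HN] := @geometric_small r (e / (rho + 1)) r0 r1.
    by rewrite divr_gt0 // ltr_wpDl.
  have {}HN n : (N <= n)%N -> r ^+ n * rho < e.
    move=> /HN; rewrite ltr_pdivlMr ?ltr_wpDl //; apply: le_lt_trans.
    by rewrite ler_wpM2l ?exprn_ge0 // lerDl.
  exists N => m n Nm Nn; wlog mn : m n Nm Nn / (m <= n)%N.
    move=> H; have [|] := leqP m n; first exact: H.
    by move=> /ltnW; rewrite Qp_absB; apply: H.
  by rewrite -(subnKC mn) (le_lt_trans (xC _ _)) // HN.
have lB : Qp_abs (l - a) <= rho.
  rewrite leNgt; apply/negP => H.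
  have [|N /(_ N (leqnn N)) HN] := Hl (Qp_abs (l - a)).
    exact: le_lt_trans H.
  have : Qp_abs (l - a) < Qp_abs (l - a); last by rewrite ltxx.
  rewrite -{1}[l](subrK (x N)) -addrA; apply: Qp_absD_lt.
    by rewrite (Qp_absB l (x N)).
  exact: le_lt_trans H.
exists l => //; apply/eqP; rewrite -subr_eq0; apply: contraT.
rewrite -Qp_abs_gt0 => H; have [N HN] := Hl _ H.
have : Qp_abs (T l - l) < Qp_abs (T l - l); last by rewrite ltxx.
rewrite -{1}[T l](subrK (x N.+1)) -addrA Qp_absD_lt ?HN //.
rewrite (le_lt_trans (TC _ _ _ _)) // Qp_absB.
rewrite (le_lt_trans _ (HN N _)) // ler_piMl ?Qp_abs_ge0 //.
exact: ltW.
Qed.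

Hypothesis p_odd : odd p.

Lemma Qp_abs2 : Qp_abs 2%:R = 1.
Proof.
rewrite -[2%:R](rmorph_nat Qp_of_rat) Qp_abs_rat.
have -> : 2%:R = (2%:Z)%:~R / (1%:Z)%:~R :> rat by rewrite divr1.
rewrite (padic_abs_frac p_pr) //= logn1 logn_prime //.
by case: eqVneq p_odd => [->|_ _].
Qed.

Lemma Qp_two_neq0 : 2%:R != 0 :> Qp.
Proof. by rewrite -Qp_abs_gt0 Qp_abs2. Qed.

Lemma Qp_sqrt (a : Qp) : Qp_abs (a - 1) < 1 ->
  exists2 y, Qp_abs (y - 1) <= Qp_abs (a - 1) & y ^+ 2 = a.
Proof.
(* Newton's method for y^2 = a with the derivative frozen at its value 2 at y = 1. As |2| = 1 for
   odd p, T contracts the ball of radius |a - 1| around 1 by the factor |a - 1|. *)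
move=> a1; pose T (y : Qp) := y - (y ^+ 2 - a) / 2%:R.
have two0 := Qp_two_neq0.
have abs_half (z : Qp) : Qp_abs (z / 2%:R) = Qp_abs z.
  by rewrite Qp_absM Qp_absV Qp_abs2 divr1.
have [|||||y yB Ty] := @Qp_banach T 1 (Qp_abs (a - 1)) (Qp_abs (a - 1)).
- exact: Qp_abs_ge0.
- exact: a1.
- move=> x Hx; have -> : T x - 1 = ((a - 1) - (x - 1) * (x - 1)) / 2%:R.
    by rewrite /T; field.
  rewrite abs_half Qp_absD_le // Qp_absN Qp_absM.
  rewrite -[X in _ <= X]mulr1 ler_pM ?Qp_abs_ge0 //.
  by rewrite (le_trans Hx) // ltW.
- move=> x y Hx Hy.
  have -> : T x - T y = - ((x - 1) + (y - 1)) * (x - y) / 2%:R.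
    by rewrite /T; field.
  rewrite abs_half Qp_absM Qp_absN ler_wpM2r ?Qp_abs_ge0 //.
  exact: Qp_absD_le.
- exact: Qp_abs_ge0.
exists y => //; move/eqP: Ty; rewrite /T -subr_eq0 addrC addKr oppr_eq0.
by rewrite mulf_eq0 invr_eq0 (negbTE two0) orbF subr_eq0 => /eqP.
Qed.

End QpAbs.

(** * Iterates of the quadratic map *)

Definition quad (K : nzRingType) (c x : K) : K := x ^+ 2 + c.

Definition quad_preper (K : nzRingType) (c x : K) : Prop :=
  exists m n, (m < n)%N /\ iter n (quad c) x = iter m (quad c) x.

Lemma quad_preper_quad (K : nzRingType) (c x : K) :
  quad_preper c x -> quad_preper c (quad c x).
Proof.
by move=> [m [n [mn E]]]; exists m, n; rewrite -!iterSr !iterS E.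
Qed.

(** The added constant may vary with the step: a constant sequence gives the iterates f^n, while the
    sequence c d^(2^(k+1)) expresses d^(2^n) f^n(z) as a polynomial in d z. *)
Fixpoint quad_seq (R : nzRingType) (e : nat -> R) (n : nat) : {poly R} :=
  if n is n'.+1 then quad_seq e n' ^+ 2 + (e n')%:P else 'X.

Lemma quad_seq_monic_size (R : idomainType) (e : nat -> R) n :
  quad_seq e n \is monic /\ size (quad_seq e n) = (2 ^ n).+1.
Proof.
elim: n => [|n [mon sz]] /=; first by rewrite monicX size_polyX.
have sz2 : size (quad_seq e n ^+ 2) = (2 ^ n.+1).+1.
  by rewrite expr2 size_mul ?monic_neq0 // sz expnS; lia.
have lt : (size (e n)%:P < size (quad_seq e n ^+ 2))%N.
  by rewrite sz2 (leq_ltn_trans (size_polyC_leq1 _)) // ltnS expn_gt0.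
split; last by rewrite size_polyDl.
by rewrite monicE lead_coefDl // -monicE monic_exp.
Qed.

Lemma quad_seq_sub_monic_size (R : idomainType) (e : nat -> R) (a : R) m n :
  (m < n)%N ->
  quad_seq e n - a *: quad_seq e m \is monic /\
  size (quad_seq e n - a *: quad_seq e m) = (2 ^ n).+1.
Proof.
have [mon sz] := quad_seq_monic_size e n; move=> mn.
have lt : (size (- (a *: quad_seq e m)) < size (quad_seq e n))%N.
  rewrite size_polyN (leq_ltn_trans (size_scale_leq _ _)) // sz.
  by have [_ ->] := quad_seq_monic_size e m; rewrite ltnS ltn_exp2l.
by rewrite monicE lead_coefDl // -monicE mon size_polyDl.
Qed.

Definition quad_iter (c : rat) : nat -> {poly rat} := quad_seq (fun=> c).

Lemma horner_quad_iter (K : comNzRingType) (phi : {rmorphism rat -> K}) c n x :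
  (map_poly phi (quad_iter c n)).[x] = iter n (quad (phi c)) x.
Proof.
elim: n => [|n IH] /=; first by rewrite map_polyX hornerX.
rewrite rmorphD rmorphXn /= map_polyC hornerD hornerC.
by rewrite horner_exp IH.
Qed.

Lemma quad_iter_sub_monic_size c m n : (m < n)%N ->
  quad_iter c n - quad_iter c m \is monic /\
  size (quad_iter c n - quad_iter c m) = (2 ^ n).+1.
Proof.
by move=> /(quad_seq_sub_monic_size (fun=> c) 1); rewrite scale1r.
Qed.

Lemma horner_quad_iter_sub (K : comNzRingType) (phi : {rmorphism rat -> K})
    c m n x :
  root (map_poly phi (quad_iter c n - quad_iter c m)) x =
  (iter n (quad (phi c)) x == iter m (quad (phi c)) x).
Proof.
by rewrite rmorphB /= rootE hornerD hornerN !horner_quad_iter subr_eq0.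
Qed.

Lemma poly_iter_fc c n : poly_iter (fc c) n = map_poly ratr (quad_iter c n).
Proof.
rewrite /poly_iter; elim: n => [|n IH] /=; first by rewrite map_polyX.
rewrite IH /fc comp_polyD expr2 comp_polyM comp_polyX -expr2 comp_polyC.
by rewrite rmorphD rmorphXn /= map_polyC.
Qed.

Lemma PrePerE c a : PrePer (fc c) a <-> quad_preper (ratr c) a.
Proof.
by split=> -[m [n [mn E]]]; exists m, n; split=> //;
  move: E; rewrite !poly_iter_fc !horner_quad_iter.
Qed.

(** Preperiodicity of a is the vanishing of a rational polynomial f^n - f^m; P divides it, so it
    also vanishes at the roots of P in any other field. *)
Lemma preper_root_minpoly (K : fieldType) (phi : {rmorphism rat -> K}) c a b
    (P : {poly rat}) :
  (forall q : {poly rat}, root (map_poly ratr q) a -> P %| q) ->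
  quad_preper (ratr c) (a : algC) -> root (map_poly phi P) b ->
  quad_preper (phi c) b.
Proof.
move=> minP [m [n [mn /eqP E]]] Pb; exists m, n; split=> //; apply/eqP.
move: E; rewrite -(horner_quad_iter_sub ratr) => /minP.
rewrite -(dvdp_map phi) -(horner_quad_iter_sub phi).
by move=> /dvdpP [q ->]; rewrite rootM Pb orbT.
Qed.

(** * Totally p-adic preperiodic points *)

Lemma quad_div (F : fieldType) (k x : F) :
  x != 0 -> - k / x ^+ 2 - 1 = - quad k x / x ^+ 2.
Proof. by move=> x0; rewrite /quad; field. Qed.

Lemma quad_sub (R : comNzRingType) (k x y : R) :
  quad k x - quad k y = (x - y) * (x + y).
Proof. by rewrite /quad; ring. Qed.

Section TotallyPadic.
Variables (p : nat) (p_pr : prime p).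
Local Notation pa := (padic_abs p).
Local Notation Qp := (Qp p_pr).
Local Notation iota := (@Qp_of_rat p p_pr).

Lemma totally_padicP (a : algC) : totally_padic p_pr a ->
  exists (P : {poly rat}) (s : seq Qp),
    [/\ P \is monic, forall q, root (map_poly ratr q) a = (P %| q)
      & map_poly iota P = \prod_(b <- s) ('X - b%:P)].
Proof.
case=> P PE [s sE]; have [Q [QE Qmon] Qmin] := minCpolyP a.
have PQ : P = Q.
  apply: (@map_poly_inj _ _ (ratr : {rmorphism rat -> algC})).
  exact: (etrans PE QE).
by exists P, s; rewrite PQ; split=> //; rewrite -PQ -map_poly_ratr_Qp.
Qed.

(** The minimal polynomial of a divides F, and a monic divisor of a product of linear factors is a
    subproduct. *)
Lemma totally_padic_root (F : {poly rat}) (s : seq Qp) (a : algC) :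
  map_poly iota F = \prod_(b <- s) ('X - b%:P) ->
  root (map_poly ratr F) a -> totally_padic p_pr a.
Proof.
move=> Fs Fa; have [P [PE Pmon] Pmin] := minCpolyP a.
exists P => //; rewrite map_poly_ratr_Qp.
move: Fa; rewrite Pmin -(dvdp_map iota) Fs => /dvdp_prod_XsubC [m].
rewrite eqp_monic ?map_monic ?monic_prod_XsubC // => /eqP ->.
by exists (mask m s).
Qed.

Lemma totally_padic_conj_preper c (a : algC) (P : {poly rat}) (s : seq Qp) :
  (forall q : {poly rat}, root (map_poly ratr q) a -> P %| q) ->
  quad_preper (ratr c) a ->
  map_poly iota P = \prod_(b <- s) ('X - b%:P) ->
  forall b, b \in s -> quad_preper (iota c) b.
Proof.
move=> Pmin aper Ps b bs; apply: (preper_root_minpoly Pmin aper).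
by rewrite /= Ps root_prod_XsubC.
Qed.

(** Here |f x| = |x|^2 > |x|, and both hypotheses pass to f x, so the absolute value strictly
    increases along the orbit. *)
Lemma quad_escape c (x : Qp) :
  1 < Qp_abs x -> pa c < Qp_abs x ^+ 2 -> ~ quad_preper (iota c) x.
Proof.
move=> x1 xc [m [n [mn E]]].
have step (y : Qp) : 1 < Qp_abs y -> pa c < Qp_abs y ^+ 2 ->
    Qp_abs y < Qp_abs (quad (iota c) y).
  move=> y1 yc; rewrite /quad addrC Qp_absDr Qp_absX ?Qp_abs_rat //.
  by rewrite expr2 ltr_pMl // (lt_trans ltr01).
have inv k : 1 < Qp_abs (iter k (quad (iota c)) x) /\
             pa c < Qp_abs (iter k (quad (iota c)) x) ^+ 2.
  elim: k => [//|k [y1 yc]] /=; set y := iter _ _ _ in y1 yc *.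
  have yy := step y y1 yc; rewrite (lt_trans y1) //; split=> //.
  by rewrite (lt_trans yc) // ltr_pXn2r // nnegrE Qp_abs_ge0.
have incr k j : Qp_abs (iter k (quad (iota c)) x) <=
                Qp_abs (iter (k + j) (quad (iota c)) x).
  elim: j => [|j IH]; rewrite ?addn0 // addnS /= (le_trans IH) // ltW //.
  by have [] := inv (k + j)%N; apply: step.
have : Qp_abs (iter m (quad (iota c)) x) < Qp_abs (iter n (quad (iota c)) x).
  rewrite -(subnKC mn) (lt_le_trans _ (incr _ _)) //=.
  by have [] := inv m; apply: step.
by rewrite E ltxx.
Qed.

Lemma quad_preper_integral c (x : Qp) :
  pa c <= 1 -> quad_preper (iota c) x -> Qp_abs x <= 1.
Proof.
move=> c1 xper; rewrite leNgt; apply/negP => x1.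
apply: (quad_escape x1 _ xper); rewrite (le_lt_trans c1) //.
by rewrite expr_gt1 // ltW // (lt_trans ltr01).
Qed.

(** If |x|^2 > |c|, then x escapes. If |x|^2 < |c|, then |f x| = |c| > 1 and |c|^2 > |c|, so f x
    escapes. *)
Lemma quad_preper_abs c (x : Qp) :
  1 < pa c -> quad_preper (iota c) x -> Qp_abs x ^+ 2 = pa c.
Proof.
move=> c1 xper; apply/eqP; rewrite eq_le !leNgt; apply/andP; split; apply/negP.
  move=> H; apply: (quad_escape _ H xper).
  have := lt_trans c1 H; rewrite expr_gt1 //; exact: Qp_abs_ge0.
move=> H; apply: (quad_escape _ _ (quad_preper_quad xper)).
  by rewrite Qp_absDr Qp_abs_rat // Qp_absX.
rewrite Qp_absDr Qp_abs_rat ?Qp_absX //.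
by rewrite expr2 ltr_pMl // (lt_trans ltr01).
Qed.

Hypothesis p_odd : odd p.

Lemma preper_is_square c (x : Qp) :
  1 < pa c -> quad_preper (iota c) x -> is_square_Qp p_pr (- c).
Proof.
move=> c1 xper; have c0 : 0 < pa c by rewrite (lt_trans ltr01).
have xc := quad_preper_abs c1 xper.
have fxc := quad_preper_abs c1 (quad_preper_quad xper).
have x0 : x != 0.
  by rewrite -Qp_abs_gt0 lt_def Qp_abs_ge0 andbT -sqrf_eq0 xc gt_eqF.
pose a := - iota c / x ^+ 2.
have [|y _ yE] := @Qp_sqrt p p_pr p_odd a.
  rewrite quad_div //.
  rewrite Qp_absM Qp_absN Qp_absV Qp_absX xc ltr_pdivrMr // mul1r.
  rewrite -(@ltr_pXn2r _ 2) ?nnegrE ?Qp_abs_ge0 ?(ltW c0) // fxc.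
  by rewrite expr2 ltr_pMl.
exists (y * x); rewrite Qp_ratr rmorphN /= exprMn yE /a mulfVK //.
exact: expf_neq0.
Qed.

(** * Inverse branches on the ball |y| <= |s|, for s^2 = -c and |c| > 1 *)

Section Branches.
Variables (c : rat) (s : Qp).
Hypotheses (c1 : 1 < pa c) (sc : s ^+ 2 = - iota c).

Let s_abs2 : Qp_abs s ^+ 2 = pa c.
Proof. by rewrite -Qp_absX sc Qp_absN Qp_abs_rat. Qed.

Lemma abs_sqrt_gt1 : 1 < Qp_abs s.
Proof. by move: c1; rewrite -s_abs2 expr_gt1 // Qp_abs_ge0. Qed.

Let s0 : s != 0.
Proof. by rewrite -Qp_abs_gt0 (lt_trans ltr01) // abs_sqrt_gt1. Qed.

Let s_gt0 : 0 < Qp_abs s. Proof. by rewrite Qp_abs_gt0. Qed.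

Let sgn (e : bool) : Qp := if e then s else - s.

Let sgn_abs e : Qp_abs (sgn e) = Qp_abs s.
Proof. by case: e; rewrite /sgn ?Qp_absN. Qed.

Let sgn_sqr e : sgn e ^+ 2 = - iota c.
Proof. by case: e; rewrite /sgn ?sqrrN. Qed.

(** Take x = t [sgn e], where t is the square root of 1 + y / s^2 close to 1: |t - 1| <= |y| / |s|^2
    <= 1 / |s|. The bound on y stands under the quantifier so that the chosen branch is a total
    function. *)
Lemma branch_ex (e : bool) (y : Qp) : exists x, Qp_abs y <= Qp_abs s ->
  Qp_abs (x - sgn e) <= 1 /\ quad (iota c) x = y.
Proof.
have [ys|] := leP (Qp_abs y) (Qp_abs s); last by exists 0.
have e0 : sgn e != 0 by rewrite -Qp_abs_eq0 sgn_abs Qp_abs_eq0.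
have [|t t1 tE] := @Qp_sqrt p p_pr p_odd (1 + y / sgn e ^+ 2).
  rewrite addrC addKr Qp_absM Qp_absV Qp_absX sgn_abs.
  rewrite ltr_pdivrMr ?exprn_gt0 // mul1r (le_lt_trans ys) //.
  by rewrite expr2 ltr_pMl // abs_sqrt_gt1.
exists (sgn e * t) => _; split; last first.
  rewrite /quad exprMn tE mulrDr mulr1 mulrC mulfVK ?expf_neq0 //.
  by rewrite sgn_sqr addrC addrA subrr add0r.
have -> : sgn e * t - sgn e = sgn e * (t - 1) by ring.
rewrite Qp_absM sgn_abs -ler_pdivlMl // mulr1 (le_trans t1) //.
rewrite addrC addKr Qp_absM Qp_absV Qp_absX sgn_abs.
by rewrite ler_pdivrMr ?exprn_gt0 // expr2 mulKf ?gt_eqF.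
Qed.

Let g e y := sval (cid (branch_ex e y)).

Let g_near e y : Qp_abs y <= Qp_abs s -> Qp_abs (g e y - sgn e) <= 1.
Proof. by rewrite /g; case: cid => x /= H /H []. Qed.

Let g_quad e y : Qp_abs y <= Qp_abs s -> quad (iota c) (g e y) = y.
Proof. by rewrite /g; case: cid => x /= H /H []. Qed.

Let g_ball e y : Qp_abs y <= Qp_abs s -> Qp_abs (g e y) <= Qp_abs s.
Proof.
move=> yB; rewrite -[g e y](subrK (sgn e)) Qp_absD_le ?sgn_abs //.
by rewrite (le_trans (g_near e yB)) // ltW // abs_sqrt_gt1.
Qed.

(** With u and v the images of y and z, y - z = (u - v)(u + v), and u + v is within 1 of twice
    [sgn e], so |u + v| = |s| because |s| > 1. *)
Let g_contr e y z : Qp_abs y <= Qp_abs s -> Qp_abs z <= Qp_abs s ->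
  Qp_abs (g e y - g e z) <= (Qp_abs s)^-1 * Qp_abs (y - z).
Proof.
move=> yB zB; rewrite ler_pdivlMl // mulrC.
have -> : y - z = (g e y - g e z) * (g e y + g e z).
  by rewrite -[y in LHS](g_quad e yB) -[z in LHS](g_quad e zB) quad_sub.
rewrite Qp_absM.
have -> : g e y + g e z =
    ((g e y - sgn e) + (g e z - sgn e)) + 2%:R * sgn e by ring.
rewrite [Qp_abs (_ + 2%:R * _)]Qp_absDr Qp_absM Qp_abs2 // mul1r sgn_abs //.
rewrite (le_lt_trans _ abs_sqrt_gt1) //.
by apply: Qp_absD_le; apply: g_near.
Qed.

Let word (w : seq bool) y := foldr g y w.

Let word_ball w y : Qp_abs y <= Qp_abs s -> Qp_abs (word w y) <= Qp_abs s.
Proof. by move=> yB; elim: w => //= e w IH; apply: g_ball. Qed.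

Let inv_lt1 : 0 <= (Qp_abs s)^-1 < 1.
Proof. by rewrite invr_ge0 Qp_abs_ge0 invf_lt1 // abs_sqrt_gt1. Qed.

Let word_contr w y z : Qp_abs y <= Qp_abs s -> Qp_abs z <= Qp_abs s ->
  Qp_abs (word w y - word w z) <= (Qp_abs s)^-1 ^+ size w * Qp_abs (y - z).
Proof.
have /andP[r0 _] := inv_lt1; move=> yB zB.
elim: w => [|e w IH] /=; first by rewrite expr0 mul1r.
rewrite (le_trans (g_contr _ _ _)) ?word_ball // exprS -mulrA.
by rewrite ler_wpM2l.
Qed.

Let word_quad w y : Qp_abs y <= Qp_abs s ->
  iter (size w) (quad (iota c)) (word w y) = y.
Proof.
move=> yB; elim: w => //= e w IH.
by rewrite -iterS iterSr g_quad ?word_ball.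
Qed.

(** Applying the quadratic map strips the first letters, and these agree because the two branches
    land within 1 of s and of -s, whose distance |2 s| = |s| exceeds 1. *)
Let word_inj w w' y z : Qp_abs y <= Qp_abs s -> Qp_abs z <= Qp_abs s ->
  size w = size w' -> word w y = word w' z -> w = w'.
Proof.
move=> yB zB; elim: w w' => [|e w IH] [|e' w'] //= [sz] E.
have E' : word w y = word w' z.
  by rewrite -(g_quad e (word_ball w yB)) E g_quad ?word_ball.
rewrite (IH w') //; congr (_ :: _); apply/eqP; apply: contraT => ee'.
have H1 := g_near e (word_ball w yB).
have H2 := g_near e' (word_ball w' zB); rewrite E in H1.
have : Qp_abs (sgn e - sgn e') <= 1.
  set x := g e' _ in H1 H2.
  have -> : sgn e - sgn e' = - (x - sgn e) + (x - sgn e') by ring.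
  by rewrite Qp_absD_le ?Qp_absN.
suff -> : Qp_abs (sgn e - sgn e') = Qp_abs s by rewrite leNgt abs_sqrt_gt1.
have -> : sgn e - sgn e' = 2%:R * sgn e.
  by case: e e' ee' {E H1 H2} => [] [] // _; rewrite /sgn; ring.
by rewrite Qp_absM Qp_abs2 // mul1r sgn_abs.
Qed.

Lemma word_fixed_point w : exists x, w != [::] ->
  Qp_abs x <= Qp_abs s /\ word w x = x.
Proof.
case: w => [|e w]; first by exists 0.
have /andP[r0 r1] := inv_lt1.
have [|||||x xB xE] := @Qp_banach p p_pr (word (e :: w)) 0 (Qp_abs s)
    (Qp_abs s)^-1; last by exists x; rewrite subr0 in xB.
- exact: r0.
- exact: r1.
- by move=> x; rewrite !subr0; apply: word_ball.
- move=> x y; rewrite !subr0 => xB yB; apply: le_trans (word_contr _ xB yB) _.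
  rewrite ler_wpM2r ?Qp_abs_ge0 //= exprS ler_piMr //.
  by rewrite exprn_ile1 // ltW.
- exact: Qp_abs_ge0.
Qed.

Lemma quad_iter_periodic_split k : (0 < k)%N ->
  exists2 r : seq Qp, uniq r &
    map_poly iota (quad_iter c k - 'X) = \prod_(b <- r) ('X - b%:P).
Proof.
move=> k0; have /choice [z zP] := word_fixed_point.
have wn0 (w : k.-tuple bool) : (w : seq bool) != [::].
  by rewrite -size_eq0 size_tuple -lt0n.
pose r := [seq z (w : k.-tuple bool) | w <- enum {: k.-tuple bool}].
(* [quad_iter c 0] is ['X], so the polynomial has degree 2^k, which is also the number of words of
   length k. *)
have [mon sz] := quad_iter_sub_monic_size c k0.
have ru : uniq r.
  rewrite map_inj_uniq ?enum_uniq // => w w' E; apply: val_inj => /=.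
  have [wB wE] := zP _ (wn0 w); have [w'B w'E] := zP _ (wn0 w').
  apply: (@word_inj _ _ (z w) (z w')); rewrite ?size_tuple //.
  by rewrite wE w'E.
exists r => //; set F := map_poly _ _.
have Fmon : F \is monic by rewrite map_monic.
have := @all_roots_prod_XsubC _ F r; rewrite (monicP Fmon) scale1r; apply.
- by rewrite size_map_poly sz size_map -cardE card_tuple card_bool.
- apply/allP => _ /mapP [w _ ->]; have [wB wE] := zP _ (wn0 w).
  rewrite (horner_quad_iter_sub iota c 0 k) /=.
  by rewrite -{1}wE -{1}(size_tuple w) word_quad.
- by rewrite uniq_rootsE.
Qed.

Lemma periodic_totally_padic k (a : algC) : (0 < k)%N ->
  iter k (quad (ratr c)) a = a -> totally_padic p_pr a.
Proof.
move=> k0 E; have [r _ rE] := quad_iter_periodic_split k0.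
apply: (totally_padic_root rE).
by rewrite (horner_quad_iter_sub ratr c 0 k) E.
Qed.

(** Every root b in Q_p of the minimal polynomial P of f a is preperiodic, so |b|^2 = |c| and b lies
    in the domain of the branches. Then X^2 + c - b = (X - x)(X + x) with x in Q_p, so P composed
    with f splits, and it vanishes at a. *)
Lemma preimage_totally_padic (a : algC) : quad_preper (ratr c) a ->
  totally_padic p_pr (quad (ratr c) a) -> totally_padic p_pr a.
Proof.
move=> aper /totally_padicP [P [t [Pmon Pmin Pt]]].
have tper := totally_padic_conj_preper _ (quad_preper_quad aper) Pt.
have {}tper b : b \in t -> quad_preper (iota c) b.
  by apply: tper => q; rewrite Pmin.
have Psplit : exists r : seq Qp,
    map_poly iota P \Po ('X^2 + (iota c)%:P) = \prod_(b <- r) ('X - b%:P).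
  rewrite Pt; elim: t tper {Pt} => [|b t IH] tper.
    by exists [::]; rewrite !big_nil -polyC1 comp_polyC.
  have [|r rE] := IH; first by move=> b' bt; apply: tper; rewrite inE bt orbT.
  have bper : quad_preper (iota c) b by apply: tper; rewrite inE eqxx.
  have bB : Qp_abs b <= Qp_abs s.
    rewrite -(@ler_pXn2r _ 2) ?nnegrE ?Qp_abs_ge0 // s_abs2.
    by rewrite (quad_preper_abs c1 bper).
  have := g_quad true bB; set x := g true b => xb.
  exists [:: x, - x & r]; rewrite !big_cons comp_polyM rE mulrA; congr (_ * _).
  rewrite comp_polyB comp_polyX comp_polyC -xb /quad polyCD polyCN.
  by rewrite rmorphXn /=; move: (iota c)%:P x%:P => k u; ring.
case: Psplit => r rE.
apply: (@totally_padic_root (P \Po ('X^2 + c%:P)) r).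
  by rewrite map_comp_poly rmorphD /= map_polyXn map_polyC.
rewrite map_comp_poly rmorphD /= map_polyXn map_polyC rootE horner_comp.
rewrite !hornerE -/(quad (ratr c) a) -rootE Pmin //.
Qed.

Lemma preper_totally_padic (a : algC) :
  quad_preper (ratr c) a -> totally_padic p_pr a.
Proof.
case=> m [n [mn E]]; elim: m n a mn E => [|m IH] [|n] // a mn E.
  exact: (@periodic_totally_padic n.+1).
apply: preimage_totally_padic; first by exists m.+1, n.+1.
by apply: (IH n) => //; rewrite -!iterSr.
Qed.

(** The polynomial f^k - X is separable because its roots in Q_p are simple, and separability does
    not depend on the field. So it has 2^k distinct roots in [algC], all preperiodic, which is more
    than a list of length k - 1 can hold. *)
Lemma infinite_PrePer : infinite_set (PrePer (fc c)).
Proof.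
move=> /finite_seqP [t tE]; pose k := (size t).+1.
have [u uu uE] := @quad_iter_periodic_split k isT.
pose F := quad_iter c k - 'X.
have [Fmon Fsz] := @quad_iter_sub_monic_size c 0 k isT.
have [r rE] := closed_field_poly_normal (map_poly ratr F : {poly algC}).
move: rE; rewrite (monicP _) ?map_monic // scale1r => rE.
have ru : uniq r.
  rewrite -separable_prod_XsubC -rE separable_map -(separable_map iota) uE.
  by rewrite separable_prod_XsubC.
have rsz : size r = (2 ^ k)%N.
  by apply: succn_inj; rewrite -(size_prod_XsubC r id) -rE size_map_poly Fsz.
have : (size r <= size t)%N.
  apply: uniq_leq_size => // a ar.
  suff : PrePer (fc c) a by rewrite tE.
  apply/PrePerE; exists 0, k; split=> //; apply/eqP.
  by rewrite -(horner_quad_iter_sub ratr c 0 k) /= rE root_prod_XsubC.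
by rewrite rsz leqNgt (leq_trans _ (ltnW (ltn_expl _ _))).
Qed.

End Branches.
End TotallyPadic.

(** * Vandermonde determinants and p-integral algebraic numbers *)

(** As Pi' / Pi is the sum of the 1 / (X - b), X^m Pi' is congruent modulo Pi to the sum of the b^m
    Pi / (X - b), whose top coefficient is the power sum. Division with remainder thus computes
    power sums inside the field of coefficients of Pi. *)
Lemma power_sum_modp (F : fieldType) (r : seq F) (m : nat) (Pi : {poly F}) :
  Pi = \prod_(b <- r) ('X - b%:P) ->
  (('X^m * Pi^`()) %% Pi)`_(size r).-1 = \sum_(b <- r) b ^+ m.
Proof.
move=> ->; set S := \sum_(b <- r) _.
suff [q [R [E szR RS]]] : exists q R : {poly F},
    [/\ 'X^m * (\prod_(b <- r) ('X - b%:P))^`() =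
        q * \prod_(b <- r) ('X - b%:P) + R, (size R <= size r)%N
      & R`_(size r).-1 = S].
  by rewrite E modp_addl_mul_small ?size_prod_XsubC ?ltnS.
rewrite {}/S; elim: r => [|b r [q [R [E szR RS]]]].
  by exists 0, 0; rewrite !big_nil derivC mulr0 mul0r addr0 size_poly0 coef0.
have : root ('X^m - (b ^+ m)%:P) b by rewrite rootE !hornerE subrr.
move=> /factor_theorem [q2 q2E].
have {}q2E : 'X^m = q2 * ('X - b%:P) + (b ^+ m)%:P by rewrite -q2E subrK.
set Pi1 := \prod_(b <- r) _ in E.
exists (q2 + q), ((b ^+ m)%:P * Pi1 + ('X - b%:P) * R); split.
- rewrite !big_cons -/Pi1 derivM derivXsubC mul1r mulrDr [in X in X + _ = _]q2E.
  by rewrite mulrCA E; ring.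
- rewrite (leq_trans (size_polyD _ _)) // geq_max; apply/andP; split.
    by rewrite mul_polyC (leq_trans (size_scale_leq _ _)) // size_prod_XsubC.
  by rewrite (leq_trans (size_polyMleq _ _)) // size_XsubC /= ltnS.
rewrite big_cons coefD coefCM mulrBl coefB coefXM coefCM -RS /=.
have -> : Pi1`_(size r) = 1.
  have /monicP := monic_prod_XsubC r xpredT id.
  by rewrite lead_coefE size_prod_XsubC.
(* For empty [r] the index [(size r).-1] is truncated to 0, but then R = 0. *)
rewrite mulr1; congr (_ + _); case: r szR {E RS Pi1} => [|b' r] szR /=.
  by move: szR; rewrite leqn0 size_poly_eq0 => /eqP ->; rewrite coef0 mulr0 subrr.
by rewrite [R`_(size r).+1]nth_default // mulr0 subr0.
Qed.

Lemma power_sum_rat (F : fieldType) (phi : {rmorphism rat -> F})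
    (P : {poly rat}) (r : seq F) m :
  map_poly phi P = \prod_(b <- r) ('X - b%:P) ->
  exists v, \sum_(b <- r) b ^+ m = phi v.
Proof.
move=> /(power_sum_modp m) <-; exists (('X^m * P^`()) %% P)`_(size r).-1.
by rewrite -coef_map /= map_modp rmorphM /= map_polyXn deriv_map.
Qed.

(** The product of the Vandermonde matrix and its transpose has power sums of [r] as entries, and
    these are rational. *)
Lemma Crat_Vandermonde_sqr (P : {poly rat}) (r : seq algC) :
  map_poly ratr P = \prod_(b <- r) ('X - b%:P) ->
  (\det (Vandermonde (size r) (\row_i r`_i))) ^+ 2 \in Crat.
Proof.
move=> PE; set V := Vandermonde _ _.
rewrite expr2 -[X in _ * X]det_tr -det_mulmx /determinant.
apply: rpred_sum => s _; rewrite rpredMsign; apply: rpred_prod => i _.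
rewrite !mxE; have [v vE] := power_sum_rat (i + s i) PE.
apply/CratP; exists v; rewrite -vE (big_nth 0) big_mkord.
by apply: eq_bigr => j _; rewrite !mxE exprD.
Qed.

Lemma det_Vandermonde_neq0 (F : fieldType) (r : seq F) : uniq r ->
  \det (Vandermonde (size r) (\row_i r`_i)) != 0.
Proof.
move=> ru; rewrite det_Vandermonde; apply/prodf_neq0 => i _.
apply/prodf_neq0 => j ij; rewrite !mxE subr_eq0 nth_uniq //.
by rewrite gt_eqF.
Qed.

(** The change of basis from the monomials is triangular with ones on the diagonal. Both estimates
    of the Vandermonde determinant rest on a choice of [Q]. *)
Lemma det_monic_basis (R : comNzRingType) n (a : 'rV[R]_n) (Q : nat -> {poly R}) :
  (forall k, (k < n)%N -> Q k \is monic /\ size (Q k) = k.+1) ->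
  \det (\matrix_(k < n, i < n) (Q k).[a 0 i]) = \det (Vandermonde n a).
Proof.
move=> HQ; pose L := \matrix_(k < n, j < n) (Q k)`_j.
have -> : \matrix_(k < n, i < n) (Q k).[a 0 i] = L *m Vandermonde n a.
  apply/matrixP => k i; rewrite !mxE (@horner_coef_wide _ n).
    by apply: eq_bigr => j _; rewrite !mxE.
  by have [_ ->] := HQ k (ltn_ord k).
rewrite det_mulmx (_ : \det L = 1) ?mul1r // det_trig.
  rewrite big1 // => k _; rewrite mxE; have [/monicP Qk sz] := HQ k (ltn_ord k).
  by rewrite -Qk lead_coefE sz.
apply/is_trig_mxP => k j kj; rewrite mxE nth_default //.
by have [_ ->] := HQ k (ltn_ord k).
Qed.

Lemma norm_det_le n (A : 'M[algC]_n) (B : algC) :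
  (forall i j, `|A i j| <= B) -> `|\det A| <= n`!%:R * B ^+ n.
Proof.
move=> AB; apply: le_trans (ler_norm_sum _ _ _) _.
apply: le_trans (_ : \sum_(s : 'S_n) B ^+ n <= _).
  apply: ler_sum => s _; rewrite normrMsign normr_prod.
  rewrite -[X in _ ^+ X](card_ord n) -prodr_const.
  by apply: ler_prod => i _; rewrite normr_ge0 AB.
by rewrite sumr_const card_Sn mulr_natl.
Qed.

Lemma det_Aint n (A : 'M[algC]_n) :
  (forall i j, A i j \in Aint) -> \det A \in Aint.
Proof.
move=> HA; apply: rpred_sum => s _; rewrite rpredMsign.
by apply: rpred_prod => i _.
Qed.

(** Gives access to the transitivity of integrality: a root of a monic polynomial with algebraic
    integer coefficients is an algebraic integer. *)
Lemma Aint_integralOver (x : algC) :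
  x \in Aint <-> integralOver (intr : int -> algC) x.
Proof.
split; last first.
  case=> q qmon qx; apply: (root_monic_Aint qx).
    exact: (monic_map (intr : {rmorphism int -> algC})).
  by apply/polyOverP => i; rewrite coef_map rpred_int.
rewrite unfold_in => /floorpP [q qE]; exists q; last by rewrite -qE root_minCpoly.
have := minCpoly_monic x; rewrite qE !monicE.
have intrI := @intr_inj algC.
rewrite lead_coef_map_inj // -[1](rmorph1 (intr : {rmorphism int -> algC})).
by move=> /eqP /intrI /eqP.
Qed.

Lemma root_monic_Aint_coef (p : {poly algC}) x :
  root p x -> p \is monic -> p \is a polyOver Aint -> x \in Aint.
Proof.
move=> px pmon /polyOverP pA; apply/Aint_integralOver.
apply: (integral_root_monic pmon px) => y /(nthP 0) [i _ <-].
exact/Aint_integralOver/pA.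
Qed.

(** * Algebraic numbers integral at p *)

Section LocalIntegers.
Variables (p : nat) (p_pr : prime p).

(* The algebraic numbers that are integral over the localization of the
   integers at p. *)
Definition local_Aint of prime p : {pred algC} :=
  fun x => `[< exists2 N : nat, coprime p N & N%:R * x \in Aint >].
Local Notation Op := (local_Aint p_pr).

Lemma local_AintP x :
  reflect (exists2 N : nat, coprime p N & N%:R * x \in Aint) (x \in Op).
Proof. exact: asboolP. Qed.

Lemma local_Aint_subring : subring_closed Op.
Proof.
split.
- by apply/local_AintP; exists 1%N; rewrite ?coprimen1 // mulr1 Aint1.
- move=> x y /local_AintP [N cN Nx] /local_AintP [M cM My].
  apply/local_AintP; exists (N * M)%N; first by rewrite coprimeMr cN.
  have -> : (N * M)%:R * (x - y) = M%:R * (N%:R * x) - N%:R * (M%:R * y) :> algC.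
    by rewrite natrM; ring.
  by rewrite rpredB // rpredM // rpred_nat.
- move=> x y /local_AintP [N cN Nx] /local_AintP [M cM My].
  apply/local_AintP; exists (N * M)%N; first by rewrite coprimeMr cN.
  by rewrite natrM mulrACA rpredM.
Qed.

HB.instance Definition _ :=
  GRing.isSubringClosed.Build algC (local_Aint p_pr) local_Aint_subring.

Lemma det_local_Aint n (A : 'M[algC]_n) :
  (forall i j, A i j \in Op) -> \det A \in Op.
Proof.
move=> HA; apply: rpred_sum => s _; rewrite rpredMsign.
by apply: rpred_prod => i _.
Qed.

Lemma padic_abs_le1_denq q : padic_abs p q <= 1 -> coprime p `|denq q|%N.
Proof.
have [->|q0] := eqVneq q 0; first by rewrite (_ : denq 0 = 1) ?coprimen1.
rewrite /padic_abs (negbTE q0) ler_pdivrMr ?mul1r; last first.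
  by rewrite exprn_gt0 // ltr0n prime_gt0.
rewrite ler_eXn2l ?ltr1n ?prime_gt1 // => H; rewrite prime_coprime //.
apply/negP => pd; have := coprime_num_den q.
have ld : (0 < logn p `|denq q|)%N.
  by rewrite logn_gt0 mem_primes p_pr pd andbT absz_gt0 denq_neq0.
have := leq_trans ld H; rewrite logn_gt0 mem_primes => /and3P [_ _ pn].
rewrite /coprimez => /eqP cop; have : (p %| 1)%N.
  by have := dvdn_gcd p `|numq q| `|denq q|; rewrite pn pd; case: cop => ->.
by rewrite dvdn1 => /eqP p1; have := prime_gt1 p_pr; rewrite p1.
Qed.

Lemma ratr_local q : padic_abs p q <= 1 -> ratr q \in Op.
Proof.
move=> /padic_abs_le1_denq cq; apply/local_AintP; exists `|denq q|%N => //.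
have -> : (`|denq q|%N)%:R * ratr q = ratr (numq q)%:~R :> algC.
  have -> : (`|denq q|%N)%:R = ratr (denq q)%:~R :> algC.
    by rewrite pmulrn absz_denq ratr_int.
  rewrite -rmorphM /= mulrC -[X in X * _]divq_num_den divfK //.
  by rewrite intr_eq0 denq_neq0.
by rewrite ratr_int Aint_int.
Qed.

(** With n the length of [r] and d = N prod (g - a) an algebraic integer, N g is a root of the monic
    polynomial prod (X - N a) - N^(n-1) d, whose coefficients are algebraic integers. *)
Lemma local_Aint_prod_sub (g : algC) (r : seq algC) :
  r != [::] -> (forall a, a \in r -> a \in Aint) ->
  \prod_(a <- r) (g - a) \in Op -> g \in Op.
Proof.
move=> r0 rA /local_AintP [N cN]; set d := N%:R * _ => dA.
apply/local_AintP; exists N => //.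
pose F := \prod_(a <- r) ('X - (N%:R * a)%:P) - (N%:R ^+ (size r).-1 * d)%:P.
have szr : (size (- (N%:R ^+ (size r).-1 * d)%:P)%R <
    size (\prod_(a <- r) ('X - (N%:R * a)%:P))%R)%N.
  rewrite size_polyN size_prod_XsubC (leq_ltn_trans (size_polyC_leq1 _)) //.
  by case: (r) r0.
apply: (@root_monic_Aint_coef F).
- rewrite rootE hornerD hornerN hornerC horner_prod subr_eq0 /d mulrA -exprSr.
  rewrite prednK ?lt0n ?size_eq0 // -(count_predT r) -iter_mulr_1 -big_const_seq.
  rewrite -big_split /=; apply/eqP; apply: eq_bigr => a _.
  by rewrite !hornerE mulrBr.
- by rewrite monicE lead_coefDl // -monicE monic_prod_XsubC.
- apply: rpredB; last by rewrite polyOverC rpredM // rpredX // rpred_nat.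
  rewrite big_seq; apply: rpred_prod => a /rA aA.
  by rewrite polyOverXsubC rpredM ?rpred_nat.
Qed.

(** Bezout for N and p^k writes x as an integral combination of N x and p^k x. *)
Lemma local_Aint_pexp x k : x \in Op -> p%:R ^+ k * x \in Aint -> x \in Aint.
Proof.
move=> /local_AintP [N cN Nx] px.
have : coprimez N%:Z (p ^ k)%N%:Z by rewrite coprimezE /= coprime_sym coprimeXl.
move=> /coprimezP [[u v] /= E].
have -> : x = u%:~R * (N%:R * x) + v%:~R * (p%:R ^+ k * x).
  rewrite -[LHS]mul1r -[1 in LHS](rmorph1 (intr : {rmorphism int -> algC})) -E.
  by rewrite rmorphD !rmorphM /= -natrX; ring.
by rewrite rpredD // rpredM // rpred_int.
Qed.

Lemma dvdn_fermat a : (p %| a ^ p - a)%N.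
Proof.
rewrite (dvdn_pcharf (pchar_Fp p_pr)) natrB; last first.
  by case: a => // a; exact: (@leq_pexp2l a.+1 1 p isT (prime_gt0 p_pr)).
by have := expf_card (a%:R : 'F_p); rewrite card_Fp // natrX => ->; rewrite subrr.
Qed.

End LocalIntegers.

Lemma map_prod_XsubC (R S : comNzRingType) (phi : {rmorphism R -> S})
    (r : seq R) :
  map_poly phi (\prod_(b <- r) ('X - b%:P)) =
  \prod_(b <- map phi r) ('X - b%:P).
Proof.
rewrite big_map rmorph_prod; apply: eq_bigr => b _.
by rewrite rmorphB /= map_polyX map_polyC.
Qed.

(** * Divisibility by p from total splitting at p *)

Section Frobenius.
Variables (p : nat) (p_pr : prime p).
Local Notation pa := (padic_abs p).
Local Notation Qp := (Qp p_pr).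
Local Notation iota := (@Qp_of_rat p p_pr).
Local Notation Op := (local_Aint p_pr).
Local Notation r := (p%:R^-1 : rat).

Lemma padic_abs_int (m : int) : pa m%:~R <= 1.
Proof.
have [->|m0] := eqVneq m 0; first by rewrite padic_abs0.
have -> : m%:~R = m%:~R / (1%:Z)%:~R :> rat by rewrite divr1.
rewrite (padic_abs_frac p_pr) //= logn1 expr0 mul1r invf_le1.
  by rewrite exprn_ege1 // ler1n prime_gt0.
by rewrite exprn_gt0 // ltr0n prime_gt0.
Qed.

Lemma padic_abs_p : pa p%:R = r.
Proof.
have E : p%:R = (p%:Z)%:~R / (1%:Z)%:~R :> rat by rewrite divr1.
rewrite {1}E (padic_abs_frac p_pr) //=; last by rewrite -lt0n prime_gt0.
by rewrite logn1 logn_prime // eqxx expr0 mul1r.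
Qed.

Lemma padic_absX x n : pa (x ^+ n) = pa x ^+ n.
Proof.
by elim: n => [|n IH]; rewrite ?expr0 ?padic_abs1 // !exprS padic_absM // IH.
Qed.

Lemma padic_int_approx (q : rat) n : pa q <= 1 ->
  exists m : int, pa (q - m%:~R) <= r ^+ n.
Proof.
move=> q1; have cq := padic_abs_le1_denq p_pr q1.
have : coprimez (denq q) (p ^ n)%N%:Z.
  by rewrite coprimezE /= coprime_sym coprimeXl.
(* The integer u inverts the denominator modulo p^n, so q minus [numq q * u] equals q v p^n. *)
move=> /coprimezP [[u v] /= E]; exists (numq q * u).
have -> : q - (numq q * u)%:~R = q * v%:~R * p%:R ^+ n.
  rewrite -mulrA.
  have -> : v%:~R * p%:R ^+ n = 1 - u%:~R * (denq q)%:~R :> rat.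
    apply/eqP; rewrite eq_sym subr_eq -natrX pmulrn -!rmorphM -rmorphD /=.
    by rewrite addrC E.
  rewrite mulrBr mulr1 rmorphM /=; congr (_ - _).
  rewrite -{2}[q]divq_num_den.
  by field; rewrite intr_eq0 denq_neq0.
rewrite !padic_absM // padic_absX padic_abs_p.
have /andP[r0 _] := inv_p_lt1 p_pr.
rewrite ler_piMl ?exprn_ge0 // -[1]mulr1.
by rewrite ler_pM ?padic_abs_ge0 ?padic_abs_int.
Qed.

(** An integer close to x is reduced modulo p^n to become nonnegative: a natural number is wanted
    because Fermat's little theorem is applied to it as a divisibility in [nat]. *)
Lemma Qp_nat_approx (x : Qp) n : Qp_abs x <= 1 ->
  exists a : nat, Qp_abs (x - a%:R) <= r ^+ n.
Proof.
have /andP[r0 r1] := inv_p_lt1 p_pr; move=> x1.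
have rn1 : r ^+ n <= 1 by rewrite exprn_ile1 // ltW.
have rn0 : 0 < r ^+ n by rewrite exprn_gt0 // invr_gt0 ltr0n prime_gt0.
have [q Hq] := Qp_dense x rn0.
have q1 : pa q <= 1.
  rewrite -(Qp_abs_rat p_pr) -[iota q](subrK x).
  by apply: Qp_absD_le x1; rewrite Qp_absB (le_trans Hq).
have [m Hm] := padic_int_approx n q1.
exists `|(m %% (p ^ n)%N%:Z)%Z|%N.
have pn0 : (p ^ n)%N%:Z != 0 by rewrite -lt0n expn_gt0 prime_gt0.
set a := absz _.
have aE : a%:R = iota (m%:~R - (m %/ (p ^ n)%N%:Z)%Z%:~R * p%:R ^+ n).
  rewrite rmorphB rmorphM rmorphXn /= !rmorph_int rmorph_nat.
  rewrite pmulrn /a gez0_abs ?modz_ge0 //.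
  have := congr1 (intr : int -> Qp) (divz_eq m (p ^ n)%N%:Z).
  rewrite rmorphD rmorphM /= -[((p ^ n)%N%:Z)%:~R]pmulrn natrX => ->.
  by rewrite addrC addKr.
rewrite aE -[x](subrK (iota q)) -addrA; apply: Qp_absD_le => //.
rewrite -rmorphB opprB addrA /= Qp_abs_rat addrAC.
rewrite (le_trans (padic_absD p_pr _ _)) // ge_max Hm /=.
rewrite padic_absM // padic_absX padic_abs_p ler_piMl ?padic_abs_int //.
exact: ltW.
Qed.

Lemma coef_prod_XsubC_le1 (s : seq Qp) : (forall b, b \in s -> Qp_abs b <= 1) ->
  forall i, Qp_abs (\prod_(b <- s) ('X - b%:P))`_i <= 1.
Proof.
elim: s => [|b s IH] Hs i.
  rewrite big_nil coef1; case: eqP => _; rewrite ?Qp_abs1 ?Qp_abs0 //.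
have {}IH : forall i, Qp_abs (\prod_(b <- s) ('X - b%:P))`_i <= 1.
  by apply: IH => b' bs; apply: Hs; rewrite inE bs orbT.
have b1 : Qp_abs b <= 1 by apply: Hs; rewrite inE eqxx.
rewrite big_cons mulrBl coefB coefXM coefCM; apply: Qp_absD_le.
  by case: eqP => _; rewrite ?Qp_abs0.
rewrite Qp_absN Qp_absM -[X in _ <= X]mulr1.
by rewrite ler_pM ?Qp_abs_ge0 ?IH.
Qed.

Lemma coef_prod_XsubC_close (s : seq Qp) (a : Qp -> Qp) (e : rat) : 0 <= e ->
  (forall b, b \in s ->
     [/\ Qp_abs b <= 1, Qp_abs (a b) <= 1 & Qp_abs (b - a b) <= e]) ->
  forall i, Qp_abs (\prod_(b <- s) ('X - b%:P) -
                    \prod_(b <- map a s) ('X - b%:P))`_i <= e.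
Proof.
move=> e0; elim: s => [|b s IH] Hs i.
  by rewrite /= big_nil subrr coef0 Qp_abs0.
rewrite /= !big_cons; set B := \prod_(b <- s) _; set A := \prod_(b <- map a s) _.
have Hs' b' : b' \in s ->
    [/\ Qp_abs b' <= 1, Qp_abs (a b') <= 1 & Qp_abs (b' - a b') <= e].
  by move=> bs; apply: Hs; rewrite inE bs orbT.
have {}IH : forall i, Qp_abs (B - A)`_i <= e by apply: IH.
have A1 : forall i, Qp_abs A`_i <= 1.
  by apply: coef_prod_XsubC_le1 => _ /mapP [b' /Hs' [_ H _] ->].
have [b1 _ be] : [/\ Qp_abs b <= 1, Qp_abs (a b) <= 1 & Qp_abs (b - a b) <= e].
  by apply: Hs; rewrite inE eqxx.
(* Exchanging the remaining roots contributes (X - b)(B - A), bounded by induction; exchanging b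
   contributes (b - a b) A, where A has coefficients of absolute value at most 1. *)
have -> : ('X - b%:P) * B - ('X - (a b)%:P) * A =
    'X * (B - A) - b%:P * (B - A) - (b - a b)%:P * A.
  by rewrite polyCB; move: (b%:P) ((a b)%:P) => u v; ring.
move: (B - A) IH => D IH; rewrite 2!coefB coefXM !coefCM.
apply: Qp_absD_le; last first.
  by rewrite Qp_absN Qp_absM -[e]mulr1 ler_pM ?Qp_abs_ge0 ?A1.
apply: Qp_absD_le; first by case: eqP => _; rewrite ?Qp_abs0.
by rewrite Qp_absN Qp_absM -[e]mul1r ler_pM ?Qp_abs_ge0 ?IH.
Qed.

Lemma horner_local_Aint (E : {poly rat}) z :
  (forall i, pa E`_i <= 1) -> z \in Op -> (map_poly ratr E).[z] \in Op.
Proof.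
move=> HE zO; rewrite horner_coef; apply: rpred_sum => i _.
by rewrite coef_map rpredM ?rpredX // ratr_local.
Qed.

(* If a is an integer approximation of a root b of P to precision p ^ n, then
   P = prod (X - a) + p ^ n E with E p-integral; evaluating at z, the product
   of the z - a is p ^ n times a p-integral number, which absorbs the n
   denominators p of the (z ^ p - z) / p - (a ^ p - a) / p. *)
Lemma frobenius_quotient_local (P : {poly rat}) (s : seq Qp) z :
  map_poly iota P = \prod_(b <- s) ('X - b%:P) ->
  (forall b, b \in s -> Qp_abs b <= 1) ->
  root (map_poly ratr P) z -> z \in Op -> (z ^+ p - z) / p%:R \in Op.
Proof.
move=> Ps s1 Pz zO; set n := size s.
have /andP[r0 r1] := inv_p_lt1 p_pr.
have p0 : p%:R != 0 :> algC by rewrite pnatr_eq0 -lt0n prime_gt0.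
have /choice [a aP] : forall x : Qp, exists a : nat,
    Qp_abs x <= 1 -> Qp_abs (x - a%:R) <= r ^+ n.
  move=> x; have [x1|] := leP (Qp_abs x) 1; last by exists 0%N.
  by have [a Ha] := Qp_nat_approx n x1; exists a.
pose A : {poly rat} := \prod_(q <- [seq (a b)%:R | b <- s]) ('X - q%:P).
have mapA (F : fieldType) (phi : {rmorphism rat -> F}) :
    map_poly phi A = \prod_(q <- [seq (a b)%:R | b <- s]) ('X - q%:P).
  rewrite map_prod_XsubC -map_comp; congr (\prod_(q <- _) _).
  by apply: eq_map => b; apply: rmorph_nat.
pose E := (p%:R ^+ n)^-1 *: (P - A).
have HE i : pa E`_i <= 1.
  rewrite coefZ padic_absM // padic_absV // padic_absX padic_abs_p.
  rewrite exprVn invrK mulrC -ler_pdivlMr ?exprn_gt0 ?ltr0n ?prime_gt0 //.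
  rewrite mul1r -(Qp_abs_rat p_pr) -coef_map rmorphB /= Ps mapA.
  apply: coef_prod_XsubC_close.
    by rewrite -exprVn exprn_ge0.
  move=> b bs; have b1 := s1 b bs; split=> //; last by rewrite -exprVn; exact: aP.
  by rewrite -(rmorph_nat iota) Qp_abs_rat pmulrn padic_abs_int.
have zA : \prod_(b <- s) (z - (a b)%:R) = - (p%:R ^+ n) * (map_poly ratr E).[z].
  have -> : map_poly (ratr : rat -> algC) E =
      (p%:R ^+ n)^-1 *: (map_poly ratr P - map_poly ratr A).
    by rewrite /E map_polyZ rmorphB /= fmorphV rmorphXn /= rmorph_nat.
  rewrite hornerZ hornerD hornerN (rootP Pz) sub0r mulrA mulNr.
  rewrite divff ?expf_neq0 // mulrNN mul1r mapA horner_prod big_map.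
  by apply: eq_bigr => b _; rewrite !hornerE.
pose h b : algC := (((a b) ^ p - a b) %/ p)%:R.
(* The cofactor of z - a in (z^p - z) - (a^p - a). *)
pose u b : algC := \sum_(i < p) z ^+ (p.-1 - i) * (a b)%:R ^+ i - 1.
have huE b : (z ^+ p - z) / p%:R - h b = (z - (a b)%:R) * (u b / p%:R).
  have hE : h b = ((a b)%:R ^+ p - (a b)%:R) / p%:R.
    apply: (mulIf p0); rewrite mulfVK // /h -natrM divnK ?dvdn_fermat //.
    rewrite natrB ?natrX //; case: (a b) => // k.
    exact: (@leq_pexp2l k.+1 1 p isT (prime_gt0 p_pr)).
  have := subrXX z (a b)%:R p; rewrite hE /u; set S := \sum_(i < p) _ => SE.
  have -> : z ^+ p = (z - (a b)%:R) * S + (a b)%:R ^+ p by rewrite -SE subrK.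
  by field.
have s0 : s != [::].
  apply: contraTneq Pz => sE; have : P = 1.
    by apply: (@map_poly_inj _ _ iota); rewrite Ps sE big_nil rmorph1.
  by move=> ->; rewrite rmorph1 rootC oner_eq0.
apply: (@local_Aint_prod_sub p p_pr _ [seq h b | b <- s]).
- by case: (s) s0.
- by move=> _ /mapP [b _ ->]; apply: rpred_nat.
rewrite big_map (eq_bigr _ (fun b _ => huE b)) big_split /= zA big_split /=.
rewrite big_const_seq count_predT iter_mulr_1 -/n exprVn.
set e := horner _ _; set U := \prod_(b <- s) u b.
have -> : - p%:R ^+ n * e * (U * p%:R ^- n) = - (e * U).
  by rewrite !mulNr [U * _]mulrC mulrACA divff ?expf_neq0 // mul1r.
rewrite rpredN rpredM ?horner_local_Aint //; apply: rpred_prod => b _.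
rewrite rpredB ?rpred1 //; apply: rpred_sum => i _.
by rewrite rpredM ?rpredX // rpred_nat.
Qed.

Lemma Vandermonde_local (z : seq algC) :
  (forall x, x \in z -> x \in Op /\ (x ^+ p - x) / p%:R \in Op) ->
  \det (Vandermonde (size z) (\row_i z`_i)) /
    p%:R ^+ (\sum_(k < size z) k %/ p)%N \in Op.
Proof.
move=> Hz; set n := size z.
have p0 : p%:R != 0 :> algC by rewrite pnatr_eq0 -lt0n prime_gt0.
pose Q k : {poly algC} := ('X^p - 'X) ^+ (k %/ p) * 'X^(k %% p).
have Fs : size ('X^p - 'X : {poly algC}) = p.+1.
  by rewrite size_polyDl ?size_polyXn // size_polyN size_polyX ltnS prime_gt1.
have Fmon : 'X^p - 'X \is @monic algC.
  rewrite monicE lead_coefDl ?lead_coefXn //.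
  by rewrite size_polyXn size_polyN size_polyX ltnS prime_gt1.
have HQ k : Q k \is monic /\ size (Q k) = k.+1.
  have mon1 := monic_exp (k %/ p) Fmon; split; first by rewrite monicMr ?monicXn.
  rewrite size_monicM // -?size_poly_eq0 ?size_polyXn // addnS /=.
  have : size (('X^p - 'X : {poly algC}) ^+ (k %/ p)) = (p * (k %/ p)).+1.
    have := size_exp ('X^p - 'X : {poly algC}) (k %/ p); rewrite Fs /= => <-.
    by rewrite prednK // lt0n size_poly_eq0 monic_neq0.
  by move=> ->; rewrite addSn mulnC -divn_eq.
rewrite -(det_monic_basis _ (fun k _ => HQ k)).
pose D : 'rV[algC]_n := \row_k p%:R ^+ (k %/ p).
pose G : 'M[algC]_n :=
  \matrix_(k, i) (((z`_i ^+ p - z`_i) / p%:R) ^+ (k %/ p) * z`_i ^+ (k %% p)).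
have -> : \matrix_(k < n, i < n) (Q k).[(\row_i z`_i) 0 i] = diag_mx D *m G.
  apply/matrixP => k i; rewrite mul_diag_mx !mxE /Q.
  rewrite hornerM horner_exp hornerXn hornerD hornerN hornerX hornerXn.
  by rewrite [RHS]mulrA -exprMn mulrC [p%:R * _]mulrC divfK // mulrC.
rewrite det_mulmx det_diag.
have -> : \prod_i D 0 i = p%:R ^+ (\sum_(k < n) k %/ p)%N.
  by rewrite expr_sum; apply: eq_bigr => i _; rewrite mxE.
rewrite mulrC mulKf ?expf_neq0 //; apply: det_local_Aint => k i; rewrite mxE.
by have [zO gO] := Hz _ (mem_nth 0 (ltn_ord i)); rewrite rpredM // rpredX.
Qed.

End Frobenius.

(** * Preperiodic points as algebraic numbers *)

Lemma horner_quad_seq_scaled (F : fieldType) (c d : F) (z : F) n : d != 0 ->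
  (quad_seq (fun k => c * d ^+ (2 ^ k.+1)) n).[d * z] =
  d ^+ (2 ^ n) * iter n (quad c) z.
Proof.
move=> d0; elim: n => [|n IH] /=; first by rewrite hornerX expr1.
rewrite hornerD hornerC horner_exp IH /quad exprMn -exprM -expnSr.
by rewrite mulrDr [c * _]mulrC.
Qed.

(** Let d be the denominator of c and W_k the scaled iterate with W_k(d z) = d^(2^k) f^k(z). Then d
    z is a root of W_n - d^(2^n - 2^m) W_m, which is monic since m < n and has algebraic integer
    coefficients because c d is an integer. *)
Lemma denq_quad_preper_Aint (c : rat) (z : algC) :
  quad_preper (ratr c) z -> (`|denq c|%N)%:R * z \in Aint.
Proof.
case=> m [n [mn E]]; set d : algC := _%:R.
have d0 : d != 0 by rewrite pnatr_eq0 absz_eq0 denq_neq0.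
have dc : ratr c * d \in Aint.
  have -> : d = ratr (denq c)%:~R.
    by rewrite /d pmulrn absz_denq ratr_int.
  rewrite -rmorphM /= -[X in X * _]divq_num_den divfK ?intr_eq0 ?denq_neq0 //.
  by rewrite ratr_int Aint_int.
have dA : d \in Aint by rewrite rpred_nat.
pose e k : algC := ratr c * d ^+ (2 ^ k.+1).
have eA k : e k \in Aint.
  rewrite /e -[(2 ^ k.+1)%N]prednK ?expn_gt0 // exprS mulrA.
  by rewrite rpredM // rpredX.
have WA k : quad_seq e k \is a polyOver Aint.
  elim: k => [|k IH] /=; first exact: polyOverX.
  by rewrite rpredD ?rpredX ?polyOverC.
have le_mn : (2 ^ m <= 2 ^ n)%N by rewrite leq_exp2l // ltnW.
pose a := d ^+ (2 ^ n - 2 ^ m).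
have [mon _] := quad_seq_sub_monic_size e a mn.
apply: (root_monic_Aint_coef _ mon).
  rewrite rootE hornerD hornerN hornerZ !horner_quad_seq_scaled // E subr_eq0.
  by rewrite /a mulrA -exprD subnK.
by rewrite rpredB // polyOverZ // rpredX.
Qed.

(** If |y| > 1 + |c|, then |f y| >= |y|^2 - |c| > |y| (1 + |c|) - |c| >= |y|, so the orbit
    escapes. *)
Lemma norm_quad_preper (c : algC) (z : algC) :
  quad_preper c z -> `|z| <= 1 + `|c|.
Proof.
move=> [m [n [mn E]]]; rewrite real_leNgt ?realE ?normr_ge0 ?addr_ge0 //.
apply/negP => zR; set R := 1 + `|c| in zR.
have step (y : algC) : R < `|y| -> `|y| < `|quad c y|.
  move=> yR; rewrite /quad.
  have H1 : `|y| ^+ 2 - `|c| <= `|y ^+ 2 + c|.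
    by have := lerB_dist (y ^+ 2) (- c); rewrite normrN normrX opprK.
  apply: lt_le_trans H1; rewrite ltrBrDr.
  have y0 : 0 < `|y| by apply: le_lt_trans yR; rewrite addr_ge0.
  have yy : `|y| * R < `|y| ^+ 2 by rewrite expr2 ltr_pM2l.
  apply: le_lt_trans yy; rewrite /R mulrDr mulr1 lerD2l ler_peMl //.
  by apply: ltW; apply: le_lt_trans yR; rewrite lerDl.
have inv k : R < `|iter k (quad c) z|.
  by elim: k => [|k IH] //=; exact: lt_trans IH (step _ IH).
have incr k j : `|iter k (quad c) z| <= `|iter (k + j) (quad c) z|.
  elim: j => [|j IH]; rewrite ?addn0 // addnS /= (le_trans IH) // ltW //.
  exact: step.
have : `|iter m (quad c) z| < `|iter n (quad c) z|.
  by rewrite -(subnKC mn) (lt_le_trans _ (incr _ _)) //=; apply: step.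
by rewrite E ltxx.
Qed.

(* The product of the iterates of the quadratic map selected by the binary
   digits of k: a monic polynomial of degree k, whose value at a preperiodic
   point is a product of at most l points of its orbit. *)
Fixpoint dyn_basis (c : algC) (l k : nat) : {poly algC} :=
  if l is l'.+1 then 'X^(odd k) * (dyn_basis c l' k./2 \Po ('X^2 + c%:P)) else 1.

Lemma horner_dyn_basis c l k z :
  (dyn_basis c l.+1 k).[z] = z ^+ odd k * (dyn_basis c l k./2).[quad c z].
Proof. by rewrite /= hornerM hornerXn horner_comp !hornerE. Qed.

Lemma dyn_basis_monic_size c l k : (k < 2 ^ l)%N ->
  dyn_basis c l k \is monic /\ size (dyn_basis c l k) = k.+1.
Proof.
elim: l k => [|l IH] k kl /=.
  by move: kl; rewrite expn0 ltnS leqn0 => /eqP ->; rewrite monic1 size_poly1.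
have [|mon sz] := IH k./2.
  by move: kl; rewrite expnS -[X in (X < _)%N -> _](odd_double_half k); lia.
have fs : size ('X^2 + c%:P : {poly algC}) = 3%N.
  by rewrite size_XnaddC.
have fm : 'X^2 + c%:P \is monic by apply: monicXnaddC.
have gm : dyn_basis c l k./2 \Po ('X^2 + c%:P) \is monic.
  by rewrite monicE lead_coef_comp ?fs // (monicP mon) (monicP fm) expr1n mulr1.
split; first by rewrite monicMr ?monicXn.
rewrite size_monicM ?monicXn ?monic_neq0 // size_polyXn.
have := size_comp_poly (dyn_basis c l k./2) ('X^2 + c%:P).
rewrite fs sz /= => H.
rewrite -[size (_ \Po _)]prednK ?lt0n ?size_poly_eq0 ?monic_neq0 // H.
rewrite -[k in RHS](odd_double_half k); lia.
Qed.

Lemma norm_dyn_basis c l k z : quad_preper c z ->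
  `|(dyn_basis c l k).[z]| <= (1 + `|c|) ^+ l.
Proof.
elim: l k z => [|l IH] k z zper; first by rewrite hornerC normr1.
rewrite horner_dyn_basis normrM exprS ler_pM //; last first.
  exact/IH/quad_preper_quad.
case: odd; last by rewrite normr1 lerDl.
by rewrite expr1 norm_quad_preper.
Qed.

(** The value is a product of l factors, each 1 or a point of the orbit of z, and one copy of d
    clears each of them. *)
Lemma dyn_basis_Aint (c : rat) l k z : quad_preper (ratr c) z ->
  (`|denq c|%N)%:R ^+ l * (dyn_basis (ratr c) l k).[z] \in Aint.
Proof.
set d : algC := _%:R => zper.
elim: l k z zper => [|l IH] k z zper; first by rewrite hornerC mul1r Aint1.
rewrite horner_dyn_basis exprS mulrACA rpredM ?IH //.
  case: odd; last by rewrite mulr1 rpred_nat.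
  by rewrite expr1 denq_quad_preper_Aint.
exact: quad_preper_quad.
Qed.

(** By minimality M is irreducible: if M = k g with g the gcd, g does not vanish at a since Q does
    not, so k does, M divides k, and g is constant. *)
Lemma minpoly_coprimep (a : algC) (M Q : {poly rat}) :
  root (map_poly ratr M) a ->
  (forall q : {poly rat}, root (map_poly ratr q) a = (M %| q)) ->
  M != 0 -> ~~ root (map_poly ratr Q) a -> coprimep M Q.
Proof.
move=> Ma Mmin M0 Qa; rewrite /coprimep.
have /dvdpP [k kE] := dvdp_gcdl M Q; set g := gcdp M Q in kE *.
have ga : ~~ root (map_poly ratr g) a.
  apply: contraNN Qa; rewrite !Mmin => /dvdp_trans; apply; exact: dvdp_gcdr.
have k0 : k != 0 by apply: contraNneq M0 => k0; rewrite kE k0 mul0r.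
have g0 : g != 0 by apply: contraNneq M0 => g0; rewrite kE g0 mulr0.
have : root (map_poly ratr k) a.
  by move: Ma; rewrite [M in map_poly _ M]kE rmorphM rootM (negbTE ga) orbF.
rewrite Mmin => /(dvdp_leq k0).
have -> : size M = (size k + size g).-1 by rewrite kE size_mul.
move: k0 g0; rewrite -!size_poly_gt0.
case: (size k) => // x _; case: (size g) => // y _; rewrite addnS /=.
by rewrite -[X in (_ <= X)%N -> _]addn0 leq_add2l leqn0 => /eqP ->.
Qed.

(** * Large Galois-stable sets of totally p-adic preperiodic points *)

Section Growth.
Variables (p : nat) (p_pr : prime p) (c : rat).
Hypothesis c1 : padic_abs p c <= 1.
Local Notation iota := (@Qp_of_rat p p_pr).

(** Each step multiplies P by the minimal polynomial M of a point outside [r]. As P does not vanish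
    at that point, M and P are coprime, so the roots stay simple. *)
Lemma separable_tp_polynomials n :
  infinite_set (PrePer (fc c) `&` Qtp p_pr) ->
  exists (P : {poly rat}) (r : seq algC) (s : seq (Qp p_pr)),
    [/\ (n <= size r)%N, uniq r, map_poly ratr P = \prod_(b <- r) ('X - b%:P),
        map_poly iota P = \prod_(b <- s) ('X - b%:P)
      & (forall z, z \in r -> quad_preper (ratr c) z) /\
        (forall b, b \in s -> Qp_abs b <= 1)].
Proof.
move=> Sinf; elim: n => [|n [P [r [s [nr ru Pr Ps [rper s1]]]]]].
  by exists 1, [::], [::]; rewrite !big_nil !rmorph1.
have [a [[/PrePerE aper atp] ar]] : exists a,
    (PrePer (fc c) `&` Qtp p_pr) a /\ ~ (a \in r).
  apply: contrapT => /forallNP H; apply: Sinf.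
  apply: (@sub_finite_set _ _ [set` r]); last exact: finite_seq.
  by move=> a Sa /=; apply: contrapT => ar; apply: (H a).
have [M [s' [Mmon Mmin Ms']]] := totally_padicP atp.
have Ma : root (map_poly ratr M) a by rewrite Mmin dvdpp.
have [r' rE] := closed_field_poly_normal (map_poly ratr M : {poly algC}).
move: rE; rewrite (monicP _) ?map_monic // scale1r => Mr'.
have M0 : M != 0 by exact: monic_neq0.
have Msep : separable_poly M.
  rewrite separable_poly.unlock; apply: (minpoly_coprimep Ma Mmin M0).
  rewrite Mmin.
  have sM : (1 < size M)%N.
    have := @root_size_gt1 _ a (map_poly ratr M : {poly algC}).
    by rewrite map_poly_eq0 size_map_poly; apply.
  have M'0 : M^`() != 0.
    (* As M is monic, the coefficient of M' in degree deg M - 1 is deg M. *)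
    apply/eqP => /(congr1 (fun q : {poly rat} => q`_(size M).-2)) /eqP.
    rewrite coef_deriv coef0 prednK; last by case: (size M) sM => [|[]].
    rewrite mulrn_eq0 -lead_coefE (monicP Mmon) oner_eq0.
    by case: (size M) sM => [|[]].
  by apply/negP => /(dvdp_leq M'0); rewrite leqNgt lt_size_deriv.
have Psep : separable_poly P.
  rewrite -(separable_map (ratr : {rmorphism rat -> algC})) Pr.
  by rewrite separable_prod_XsubC.
have cop : coprimep M P.
  by apply: (minpoly_coprimep Ma Mmin M0); rewrite Pr root_prod_XsubC; apply/negP.
have r'per z : z \in r' -> quad_preper (ratr c) z.
  move=> zr'; apply: (@preper_root_minpoly algC ratr c a z M _ aper).
    by move=> q; rewrite Mmin.
  by rewrite Mr' root_prod_XsubC.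
have MPr : map_poly (ratr : rat -> algC) (M * P) =
    \prod_(b <- r' ++ r) ('X - b%:P).
  by rewrite rmorphM /= Mr' Pr big_cat.
exists (M * P), (r' ++ r), (s' ++ s); split=> //.
- rewrite size_cat -add1n leq_add //.
  have : root (map_poly ratr M) a by [].
  by rewrite Mr' root_prod_XsubC; case: (r').
- rewrite -separable_prod_XsubC -MPr separable_map separable_mul.
  by rewrite Msep Psep cop.
- by rewrite rmorphM /= Ms' Ps big_cat.
split=> [z|b]; rewrite mem_cat => /orP []; auto.
move=> bs'; apply: (quad_preper_integral c1).
by apply: (totally_padic_conj_preper _ aper Ms' bs') => q; rewrite Mmin.
Qed.

End Growth.

(** * Counting *)

(** Twice the sum over k < n of the inequalities k <= p (floor (k / p) + 1). *)
Lemma sum_divn_ge p n : (0 < p)%N ->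
  (n * n.-1 <= 2 * p * (\sum_(k < n) k %/ p + n))%N.
Proof.
move=> p0; have H : (\sum_(k < n) k <= p * (\sum_(k < n) k %/ p + n))%N.
  rewrite mulnDr big_distrr /= -[n in (_ + p * n)%N]card_ord -sum1_card.
  rewrite big_distrr -big_split /=; apply: leq_sum => k _.
  by rewrite {1}(divn_eq k p) mulnC leq_add2l muln1 ltnW // ltn_mod.
have E : (n * n.-1 = 2 * \sum_(k < n) k)%N.
  elim: n {H} => [|n IH]; first by rewrite big_ord0.
  rewrite big_ord_recr /= mulnDr -IH; case: n {IH} => //= n; lia.
by rewrite E -mulnA leq_mul2l.
Qed.

(** For m >= K + 4 one has K (m + 1) < m^2 <= 2^m. *)
Lemma linear_lt_exp2 K m : (K + 4 <= m)%N -> (K * m.+1 < 2 ^ m)%N.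
Proof.
have sq k : (4 <= k)%N -> (k * k <= 2 ^ k)%N.
  elim: k => // k IH; rewrite leq_eqVlt => /orP [/eqP <- //|].
  by rewrite ltnS => k4; have := IH k4; rewrite expnS; nia.
by move=> Km; have := sq m; nia.
Qed.

Lemma fact_exp_lt_exp_sum_divn p e : (1 < p)%N ->
  exists N, forall n, (N <= n)%N -> exists2 l, (n <= 2 ^ l)%N &
    (n`! * 2 ^ (e * (n * l)) < p ^ (\sum_(k < n) k %/ p))%N.
Proof.
(* If T <= (e + 1) n l, then [sum_divn_ge] gives n (n - 1) <= 2 p ((e + 1) n l + n) <= K n l. *)
move=> p1; pose K := (2 * p * (e + 2))%N.
(* This bound forces l > K + 5, so that K l < 2^(l-1) < n by [linear_lt_exp2]. *)
exists (2 ^ (K + 5)).+1 => n nN; have n1 : (1 < n)%N.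
  by apply: leq_trans nN; rewrite ltnS expn_gt0.
exists (up_log 2 n); first exact: up_logP.
have nl := up_logP n (isT : (1 < 2)%N).
have := up_log_gtn (isT : (1 < 2)%N) n1; move: nl; set l := up_log 2 n => nl ln.
have lK : (K + 5 < l)%N.
  by rewrite -(ltn_exp2l _ _ (isT : (1 < 2)%N)) (leq_trans nN).
have fl : (n`! <= 2 ^ (n * l))%N.
  rewrite fact_prod mulnC expnM -[X in (_ <= _ ^ X)%N](subn0 n) -subSS.
  rewrite -prod_nat_const_nat !big_nat; apply: leq_prod => i /andP [_ iN].
  by rewrite (leq_trans _ nl).
apply: leq_ltn_trans (_ : 2 ^ ((e + 1) * (n * l)) < _)%N.
  by rewrite addn1 mulSn expnD leq_mul2r fl orbT.
set T := \sum_(k < n) _.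
apply: leq_trans (_ : 2 ^ T <= _)%N; last first.
  by case: (posnP T) => [-> //|T0]; rewrite leq_exp2r.
rewrite ltn_exp2l //.
have HT := sum_divn_ge n (ltnW p1); rewrite -/T in HT.
have Hl : (K * l < n.-1)%N.
  have : (K * l.-1.+1 < 2 ^ l.-1)%N by apply: linear_lt_exp2; lia.
  by rewrite prednK; lia.
rewrite ltnNge; apply/negP => TH.
have : (n * n.-1 <= 2 * p * ((e + 1) * (n * l) + n))%N.
  by apply: leq_trans HT _; rewrite leq_mul2l leq_add2r TH orbT.
have : (2 * p * ((e + 1) * (n * l) + n) <= n * (K * l))%N.
  have -> : (n * (K * l) = 2 * p * ((e + 1) * (n * l) + n * l))%N.
    by rewrite /K; ring.
  by rewrite leq_mul2l leq_add2l leq_pmulr ?orbT // (leq_ltn_trans _ lK).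
have : (n * (K * l) < n * n.-1)%N by rewrite ltn_mul2l Hl (ltnW n1).
by lia.
Qed.

(** * Comparison of the archimedean and p-adic estimates *)

Lemma Vandermonde_size_bound p (p_pr : prime p) c (P : {poly rat})
    (r : seq algC) (s : seq (Qp p_pr)) (e l : nat) :
  padic_abs p c <= 1 -> uniq r ->
  map_poly ratr P = \prod_(b <- r) ('X - b%:P) ->
  map_poly (@Qp_of_rat p p_pr) P = \prod_(b <- s) ('X - b%:P) ->
  (forall z, z \in r -> quad_preper (ratr c) z) ->
  (forall b, b \in s -> Qp_abs b <= 1) ->
  (`|denq c|%N)%:R * (1 + `|ratr c|) <= 2%:R ^+ e :> algC ->
  (size r <= 2 ^ l)%N ->
  (p ^ (\sum_(k < size r) k %/ p) <= (size r)`! * 2 ^ (e * (size r * l)))%N.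
Proof.
move=> c1 ru Pr Ps rper s1 de nl.
set n := size r in nl *; set T := (\sum_(k < n) k %/ p)%N.
set d : algC := (`|denq c|%N)%:R in de.
pose V := \det (Vandermonde n (\row_i r`_i)).
have p0 : p%:R != 0 :> algC by rewrite pnatr_eq0 -lt0n prime_gt0.
have d0 : d != 0 by rewrite pnatr_eq0 absz_eq0 denq_neq0.
have V0 : V != 0 by exact: det_Vandermonde_neq0.
pose B : 'M[algC]_n :=
  \matrix_(k, i) (dyn_basis (ratr c) l k).[(\row_i r`_i) 0 i].
have BV : \det B = V.
  apply: det_monic_basis => k kn; apply: dyn_basis_monic_size.
  exact: leq_trans kn nl.
have rP (i : 'I_n) : quad_preper (ratr c) r`_i by apply/rper/mem_nth.
have VB : `|V| <= n`!%:R * ((1 + `|ratr c|) ^+ l) ^+ n.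
  by rewrite -BV; apply: norm_det_le => k i; rewrite !mxE norm_dyn_basis.
have dVA : (d ^+ l) ^+ n * V \in Aint.
  rewrite -BV -detZ; apply: det_Aint => k i; rewrite !mxE.
  exact: dyn_basis_Aint.
(* As p^T x is an algebraic integer and x is integral at p, x is an algebraic integer. Its square is
   rational and nonzero, hence a nonzero integer, and |x| >= 1. *)
pose x := (d ^+ l) ^+ n * V / p%:R ^+ T.
have xA : x \in Aint.
  apply: (@local_Aint_pexp p p_pr _ T); last by rewrite mulrC mulfVK ?expf_neq0.
  rewrite /x -mulrA rpredM //; first by rewrite rpredX // rpredX // rpred_nat.
  apply: Vandermonde_local => z zr; have zper := rper z zr.
  have zO : z \in local_Aint p_pr.
    apply/local_AintP; exists `|denq c|%N; first exact: padic_abs_le1_denq.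
    exact: denq_quad_preper_Aint.
  split=> //; apply: (frobenius_quotient_local Ps s1) => //.
  by rewrite Pr root_prod_XsubC.
have x2 : x ^+ 2 \in Num.int.
  apply: Cint_rat_Aint; last by rewrite rpredX.
  rewrite /x 2!exprMn exprVn; apply: rpredM; last first.
    by rewrite rpredV !rpredX ?rpred_nat.
  apply: rpredM; first by rewrite !rpredX ?rpred_nat.
  exact: (Crat_Vandermonde_sqr Pr).
have x1 : 1 <= `|x|.
  have x0 : x != 0 by rewrite !mulf_neq0 ?invr_eq0 ?expf_neq0.
  by have := norm_intr_ge1 x2 (expf_neq0 2 x0); rewrite normrX expr_ge1.
rewrite -(ler_nat algC) natrX natrM natrX.
have pT : 0 < p%:R ^+ T :> algC by rewrite exprn_gt0 // ltr0n prime_gt0.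
move: x1; rewrite /x normf_div [`|p%:R ^+ T|]ger0_norm ?(ltW pT) //.
rewrite ler_pdivlMr // mul1r => /le_trans; apply.
rewrite normrM !normrX [`|d|]ger0_norm ?ler0n //.
apply: le_trans (_ : (d ^+ l) ^+ n * (n`!%:R * ((1 + `|ratr c|) ^+ l) ^+ n) <= _).
  by rewrite ler_wpM2l // !exprn_ge0.
rewrite mulrCA ler_wpM2l ?ler0n // -!exprMn exprM [(n * l)%N]mulnC exprM.
by rewrite !lerXn2r ?nnegrE ?exprn_ge0 ?mulr_ge0 ?addr_ge0 ?ler0n.
Qed.

Lemma finite_tp_preper p (p_pr : prime p) c : padic_abs p c <= 1 ->
  finite_set (PrePer (fc c) `&` Qtp p_pr).
Proof.
move=> c1; apply: contrapT => Sinf.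
pose A : algC := (`|denq c|%N)%:R * (1 + `|ratr c|).
have A0 : 0 <= A by rewrite mulr_ge0 ?addr_ge0 ?ler0n.
have := archi_boundP A0; set e := Num.Def.archi_bound A => Ae.
have {}Ae : A <= 2%:R ^+ e.
  by rewrite (le_trans (ltW Ae)) // -natrX ler_nat ltnW // ltn_expl.
have [N HN] := fact_exp_lt_exp_sum_divn e (prime_gt1 p_pr).
have [P [r [s [nr ru Pr Ps [rper s1]]]]] := separable_tp_polynomials c1 N Sinf.
have [l nl] := HN _ nr; rewrite ltnNge => /negP; apply.
exact: (Vandermonde_size_bound c1 ru Pr Ps rper s1).
Qed.

Theorem theorem1p3 (p : nat) (p_pr : prime p) (p_odd : odd p) (c : rat) :
  [/\ padic_abs p c <= 1 -> finite_set (PrePer (fc c) `&` Qtp p_pr),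
      1 < padic_abs p c -> ~ is_square_Qp p_pr (- c) ->
        PrePer (fc c) `&` Qtp p_pr = set0
    & 1 < padic_abs p c -> is_square_Qp p_pr (- c) ->
        PrePer (fc c) `<=` Qtp p_pr /\
        infinite_set (PrePer (fc c) `&` Qtp p_pr)].
Proof.
split=> [c1|c1 nsq|c1 [s sE]]; first exact: finite_tp_preper.
  apply/seteqP; split=> // a [/PrePerE aper /totally_padicP [P [s [_ Pmin Ps]]]].
  (* If there were no root in Q_p, then P would be 1, which does not vanish at a. *)
  have [b bs] : exists b, b \in s.
    case: s Ps => [|b s]; last by exists b; rewrite inE eqxx.
    rewrite big_nil => E; have P1 : P = 1.
      by apply: (@map_poly_inj _ _ (@Qp_of_rat p p_pr)); rewrite E rmorph1.
    by have := Pmin P; rewrite dvdpp P1 rmorph1 rootC oner_eq0.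
  apply: nsq; apply: (preper_is_square p_odd c1 (x := b)).
  by apply: (totally_padic_conj_preper _ aper Ps bs) => q; rewrite Pmin.
have {}sE : s ^+ 2 = - @Qp_of_rat p p_pr c by rewrite sE Qp_ratr rmorphN.
have sub : PrePer (fc c) `<=` Qtp p_pr.
  by move=> a /PrePerE /(preper_totally_padic p_odd c1 sE).
split=> //; apply: sub_infinite_set (infinite_PrePer p_odd c1 sE).
by move=> a aper; split=> //; exact: sub.
Qed.
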